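(* Let $(\xi_n)$ be a sequence of stationary point processes on $\mathbb{R}$ with intensities $0<I_{\xi_n}<\infty$, and for each $n$ let $\eta_n$ be a point process given by the Palm distribution $Q_{\xi_n}$ of $\xi_n$, such that $\sup_n\mathbb{E}\,\tau_1(\eta_n)<\infty$. Let $\rho$ be a Borel probability measure on $\mathbb{R}_{\ge0}$ and $F(R)=\rho(\mathbb{R}_{>R})$. Then the following are equivalent. (i) $\mathbb{E}\,\tau_1(\eta_n)\;\mathbb{P}(\tau_1(\xi_n)\le R\mid\xi_n\ne0)\to\int_0^RF(u)\,du$ as $n\to\infty$, for every $R\ge0$; (ii) $\mathbb{E}\,g(\tau_1(\eta_n))\to\int_0^\infty g(u)\,\rho(du)$ as $n\to\infty$, for every bounded continuous $g:\mathbb{R}_{\ge0}\to\mathbb{R}$.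
   Context: Point processes: $\mathcal{M}(\mathbb{R})$ is the space of locally finite Borel measures on $\mathbb{R}$ with the vague topology, and $\mathcal{N}(\mathbb{R})$ its closed subset of integer-valued measures (values in $\mathbb{Z}\cup\{\infty\}$ on Borel sets). A point process on $\mathbb{R}$ is a random measure in $\mathcal{N}(\mathbb{R})$. For $\zeta\in\mathcal{N}(\mathbb{R})$ write $\zeta=\sum_j\delta_{\tau_j(\zeta)}$, with the convention that $\tau_j\le\tau_{j+1}$, and $\tau_0\le0<\tau_1$ if there are non-positive $\tau_j$; thus $\tau_1(\zeta)$ is the position of the first atom of $\zeta$ in $\mathbb{R}_{>0}$. Stationarity: for $u\in\mathbb{R}$ the shift is $\theta^u\zeta B=\zeta(B+u)$ for Borel sets $B\subset\mathbb{R}$. A random measure $\zeta$ in $\mathcal{M}(\mathbb{R})$ is stationary if $\theta^u\zeta$ has the same distribution as $\zeta$ for all $u\in\mathbb{R}$. Its intensity is $I_\zeta=\mathbb{E}\,\zeta(0,R]/R$, which is independent of the choice of $R>0$. Palm distribution: for a stationary random measure $\xi$ on $\mathbb{R}$ with $0<I_\xi<\infty$, the Palm distribution $Q_\xi$ is defined by $$Q_\xi f=\frac1{I_\xi\operatorname{Leb}B}\,\mathbb{E}\int_Bf(\theta^u\xi)\,\xi(du)$$ for every measurable $f:\mathcal{M}(\mathbb{R})\to\mathbb{R}_{\ge0}$, where $\operatorname{Leb}$ is Lebesgue measure and $B\subset\mathbb{R}$ is a given Borel set with $\operatorname{Leb}B>0$ (the definition does not depend on the choice of $B$). That $\eta$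 is given by (distributed according to) $Q_\xi$ means $\mathbb{E}f(\eta)=Q_\xi f$ for all such $f$.
   Formalization: The processes ξ_n are additionally assumed almost surely simple (no multiple atoms); without this the equivalence fails, since the Palm distribution weights atoms by multiplicity while τ_1(ξ_n) ignores it. *)

(* Defs.v *)
From HB Require Import structures.
From mathcomp Require Import all_boot all_order all_algebra.
From mathcomp Require Import all_classical all_reals all_analysis.

Set Implicit Arguments.
Unset Strict Implicit.
Unset Printing Implicit Defensive.

Import Order.TTheory GRing.Theory Num.Theory.
Import numFieldNormedType.Exports.

Local Open Scope classical_set_scope.
Local Open Scope ring_scope.

Definition locally_finite (R : realType)
    (mu : set (measurableTypeR R) -> \bar R) : Prop :=
  forall K : set R, compact K -> (mu K < +oo)%E.

Record lfMeasure (R : realType) := LFMeasure {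
  lf_measure :> {measure set (measurableTypeR R) -> \bar R} ;
  lf_finite : locally_finite lf_measure }.

Lemma locally_finite_mzero (R : realType) :
  locally_finite (@mzero _ (measurableTypeR R) R).
Proof. by move=> K _; rewrite /mzero ltry. Qed.

Definition zero_measure (R : realType) : lfMeasure R :=
  LFMeasure (@locally_finite_mzero R).

(* A measure is a function on all sets that is only constrained on the
   measurable ones, so "= zero_measure R" would be too strong a condition. *)
Definition is_zero (R : realType) (z : lfMeasure R) : Prop :=
  forall A : set (measurableTypeR R), measurable A -> z A = 0%E.

HB.instance Definition _ (R : realType) := gen_eqMixin (lfMeasure R).
HB.instance Definition _ (R : realType) := gen_choiceMixin (lfMeasure R).
HB.instance Definition _ (R : realType) :=
  isPointed.Build (lfMeasure R) (zero_measure R).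

Definition test_function (R : realType) : Type :=
  {f : R -> R | continuous f /\ compact (closure [set x | f x != 0])}.

Definition vague_eval (R : realType) (z : lfMeasure R) :
    prod_topology (fun _ : test_function R => R) :=
  fun f => Rintegral z setT (sval f).

(* The vague topology is the coarsest one that makes z |-> \int f dz continuous
   for every test function f. *)
HB.instance Definition _ (R : realType) :=
  Topological.copy (lfMeasure R) (initial_topology (@vague_eval R)).

Definition borelM (R : realType) : measurableType _ :=
  g_sigma_algebraType (@open (lfMeasure R)).

Section shift.
Context (R : realType).
Implicit Types (u : R) (z : lfMeasure R).

Definition shift_measure u z (B : set (measurableTypeR R)) : \bar R :=
  z [set x + u | x in B].

Definition translation u (x : measurableTypeR R) : measurableTypeR R := x - u.

Lemma measurable_translation u : measurable_fun setT (translation u).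
Proof.
by apply: (@measurable_realfun.measurable_funB) => //; exact: measurable_cst.
Qed.

Lemma shift_measureE u z : shift_measure u z = pushforward z (translation u).
Proof.
apply/funext => B; rewrite /shift_measure /pushforward; congr (lf_measure z _).
apply/seteqP; split=> [_ [x Bx <-]|x /= Bx] /=.
  by rewrite /translation addrK.
by exists (translation u x) => //; rewrite /translation subrK.
Qed.

Let shift0 u z : shift_measure u z set0 = 0%E.
Proof. by rewrite /shift_measure image_set0 measure0. Qed.

Let shift_ge0 u z B : (0 <= shift_measure u z B)%E.
Proof. exact: measure_ge0. Qed.

Let shift_sigma_additive u z : semi_sigma_additive (shift_measure u z).
Proof.
rewrite shift_measureE.
exact: (@measure_semi_sigma_additive _ _ _
  (measure_function_pushforward__canonical__measure_function_Measure
     z (measurable_translation u))).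
Qed.

HB.instance Definition _ u z := isMeasure.Build _ _ _ (shift_measure u z)
  (shift0 u z) (shift_ge0 u z) (@shift_sigma_additive u z).

Lemma locally_finite_shift u z : locally_finite (shift_measure u z).
Proof.
move=> K cK; apply: lf_finite.
apply: continuous_compact => //; apply: continuous_subspaceT => x.
by apply: cvgD; [exact: cvg_id|exact: cvg_cst].
Qed.

Definition shift u z : borelM R := LFMeasure (@locally_finite_shift u z).

End shift.

Definition integer_valued (R : realType) (z : lfMeasure R) : Prop :=
  forall A : set (measurableTypeR R), measurable A ->
    z A = +oo%E \/ exists k : int, z A = (k%:~R)%:E.

(* Position of the first atom in the open half-line; +oo if there is none. *)
Definition tau1 (R : realType) (z : lfMeasure R) : \bar R :=
  ereal_inf [set x%:E | x in [set x : R | 0 < x /\ (0 < z [set x])%E]].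

Section random_measures.
Context (R : realType) (d : measure_display) (T : measurableType d).
Implicit Types (P : probability T R) (xi : {mfun T >-> borelM R}).

Definition point_process xi : Prop := forall w, integer_valued (xi w).

(* Palm distributions weight an atom by its multiplicity, while tau1 does not
   see multiplicities; the relation between the law of tau1 under a stationary
   process and under its Palm distribution (Palm-Khinchin) needs the process to
   be simple. *)
Definition simple_process P xi : Prop :=
  {ae P, forall w, forall x : R, lf_measure (xi w) [set x] <= 1}%E.

Definition stationary P xi : Prop :=
  forall (u : R) (A : set (borelM R)), measurable A ->
    P [set w | A (shift u (xi w))] = P [set w | A (xi w)].

(* For stationary xi this does not depend on r > 0. *)
Definition intensity P xi (r : R) : \bar R :=
  ((\int[P]_w lf_measure (xi w) `]0%R, r]%classic) / r%:E)%E.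

(* For stationary xi this does not depend on the Borel set B, as long as
   0 < Leb B < +oo, nor on r > 0. *)
Definition palm P xi (r : R) (B : set R) (f : borelM R -> R) : \bar R :=
  ((intensity P xi r * lebesgue_measure B)^-1 *
   \int[P]_w \int[lf_measure (xi w)]_(u in B) (f (shift u (xi w)))%:E)%E.

Definition cond_prob P (A B : set T) : \bar R := (P (A `&` B) / P B)%E.

End random_measures.

Definition palm_distributed (R : realType) (r : R) (B : set R)
    (d d' : measure_display) (T : measurableType d) (T' : measurableType d')
    (P : probability T R) (xi : {mfun T >-> borelM R})
    (P' : probability T' R) (eta : {mfun T' >-> borelM R}) : Prop :=
  forall f : borelM R -> R, measurable_fun setT f -> (forall z, 0 <= f z) ->
    (\int[P']_w (f (eta w))%:E = palm P xi r B f)%E.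

(* Main.v *)
Require Import Defs.
From HB Require Import structures.
From mathcomp Require Import all_boot all_order all_algebra.
From mathcomp Require Import all_classical all_reals all_analysis.
From mathcomp Require Import measurable_realfun ring.

Set Implicit Arguments.
Unset Strict Implicit.
Unset Printing Implicit Defensive.

Import Order.TTheory GRing.Theory Num.Theory.
Import numFieldNormedType.Exports.

Local Open Scope classical_set_scope.
Local Open Scope ring_scope.
Local Open Scope ereal_scope.

(** Both statements say that the expectations of [min(tau1 eta_n, S)] converge,
for every [S >= 0], to the expectation of [min(X, S)] with [X] distributed
according to [rho].

For (i), this is a Palm-Khinchin formula, [mean_tau1_cond_prob]: for a
stationary simple point process [xi] with Palm version [eta],
[E tau1(eta) * P(tau1(xi) <= S | xi <> 0) = E min(tau1(eta), S)],
whereas [\int_[0, S] F = E min(X, S)] by Tonelli ([integral_tail]).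

The formula follows from [I * E min(tau1(eta), S) = P(xi(0, S] > 0)], where [I]
is the intensity.  Say that an atom [u] covers [x] when [x] lies in [[u, u + S[]
and [xi] has no atom in []u, x]]; the set of points covered by [u] has length
[min(tau1(theta^u xi), S)].  So, by the definition of the Palm distribution,
[I |B| E min(tau1(eta), S)] is the expected integral over [x] of the number of
atoms in [B] that cover [x].  Recentre at each [x] using stationarity, then
integrate over [x] first: every atom that covers the origin is counted with
weight [|B|].  The origin is covered by at most one atom, the last one in
[]-S, 0]], and by one exactly when [xi(]-S, 0]) > 0]; here simplicity is used.
This is [expected_wait]; the factor [|B|] then cancels.  Letting [S] grow gives
[I * E tau1(eta) = P(xi <> 0)] ([mean_tau1]), and a quotient gives the formula.

The Borel sigma-algebra of the vague topology enters through two facts: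
evaluations on Borel sets are measurable ([measurable_eval]), and shifts are
continuous, hence measurable ([shift_continuous]).

For (ii), the functions [min(., S)] are bounded and continuous, which gives one
direction.  Conversely their linear span together with the constants contains
the piecewise linear interpolations of a bounded continuous [g] that are
constant beyond a point [K + 1].  It also contains the ramp that rises from [0]
to [1] between [K] and [K + 1]; the convergence of its expectation bounds the
mass beyond [K + 1] for all large [n] at once, which is tightness
([min_cvg_weak]). *)

Local Notation shift := Defs.shift.

(** * Measurability of evaluations, kernels and shifts *)

HB.instance Definition _ (R : realType) := gen_eqMixin (test_function R).

Section interval_evaluations.
Context {R : realType}.
Implicit Types (z : lfMeasure R) (a b : R).

Lemma vague_coord_continuous (f : test_function R) :
  continuous (fun z : lfMeasure R => Rintegral z setT (sval f)).
Proof.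
move=> z.
have c1 := @initial_continuous (lfMeasure R) _ (@vague_eval R) z.
have c2 := @proj_continuous (test_function R) (fun=> R) f (vague_eval z).
exact: (continuous_comp c1 c2).
Qed.

Lemma vague_coord_measurable (f : test_function R) :
  measurable_fun setT (fun z : borelM R => Rintegral z setT (sval f)).
Proof.
apply: (measurability _ (measurable_realfun.RGenOpens.measurableE R)).
move=> _ [_ [a [b ->] <-]]; rewrite setTI.
apply: sub_sigma_algebra.
by have /continuousP := @vague_coord_continuous f; apply; exact: interval_open.
Qed.

(** Tents on []a, b[] have compact support and increase to the indicator of
[]a, b[]: they carry measurability from integrals of test functions to masses of
intervals. *)
Definition tent a b (n : nat) (x : R) : R :=
  (Num.min 1 (n%:R * Num.max 0 (Num.min (x - a) (b - x))))%R.

Lemma tent_continuous a b n : continuous (tent a b n).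
Proof.
move=> x.
apply: (@continuous_min R R (cst 1%R) (fun x => n%:R * Num.max 0 (Num.min (x - a) (b - x)))%R).
  exact: cvg_cst.
apply: cvgM; first exact: cvg_cst.
apply: (@continuous_max R R (cst 0%R) (fun x => Num.min (x - a) (b - x))%R).
  exact: cvg_cst.
by apply: (@continuous_min R R (fun x => x - a)%R (fun x => b - x)%R);
  apply: cvgB; (exact: cvg_id || exact: cvg_cst).
Qed.

Lemma tent_ge0 a b n x : (0 <= tent a b n x)%R.
Proof. by rewrite /tent le_min ler01 /= mulr_ge0// le_max lexx. Qed.

Lemma tent_out a b n x : ~ (a < x < b)%R -> tent a b n x = 0%R.
Proof.
move=> /negP; rewrite negb_and -!leNgt => xab.
rewrite /tent; have -> : Num.max 0%R (Num.min (x - a)%R (b - x)%R) = 0%R.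
  by apply/max_idPl; rewrite ge_min !subr_le0.
by rewrite mulr0; apply/min_idPr.
Qed.

Lemma tent_compact a b n : compact (closure [set x | tent a b n x != 0%R]).
Proof.
have sub : closure [set x | tent a b n x != 0%R] `<=` `[a, b]%classic.
  have cab : closed (`[a, b]%classic : set R) by exact: itv_closed.
  move/closure_id : cab => ->; apply: closure_subset => x /= /eqP tx0.
  rewrite /= in_itv/=; apply: contrapT => nx; apply: tx0; apply: tent_out.
  by move=> /andP[ax xb]; apply: nx; rewrite !ltW.
apply: (subclosed_compact _ (@segment_compact _ a b) sub).
exact: closed_closure.
Qed.

Definition tent_test a b n : test_function R :=
  exist _ (tent a b n) (conj (@tent_continuous a b n) (@tent_compact a b n)).

Lemma tent_nd a b x m n : (m <= n)%N -> (tent a b m x <= tent a b n x)%R.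
Proof.
move=> mn; rewrite /tent le_min ge_min lexx/= ge_min.
by rewrite ler_wpM2r ?ler_nat ?orbT// le_max lexx.
Qed.

Lemma tent_cvg a b x :
  (tent a b n x)%:E @[n --> \oo] --> (\1_`]a, b[%classic x : R)%:E.
Proof.
have [|] := boolP (x \in `]a, b[%classic); rewrite indicE => xab; last first.
  rewrite (negbTE xab).
  have h n : tent a b n x = 0%R.
    by apply: tent_out; move/negP : xab; rewrite inE/= in_itv.
  by under eq_fun do rewrite h; exact: cvg_cst.
rewrite xab; apply: cvg_near_cst.
move: xab; rewrite inE/= in_itv/= => /andP[ax xb].
pose e := Num.min (x - a)%R (b - x)%R.
have e0 : (0 < e)%R by rewrite lt_min !subr_gt0 ax.
exists (Num.bound e^-1) => // n /= en.
rewrite /tent -/e (max_idPr (ltW e0)); congr (_%:E); apply/min_idPl.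
rewrite -ler_pdivrMr// div1r.
have := archi_boundP (ltW (_ : 0 < e^-1)%R); rewrite invr_gt0 => /(_ e0)/ltW/le_trans.
by apply; rewrite ler_nat.
Qed.

Lemma lf_itv_lty z (i : interval R) a b : [set` i] `<=` `[a, b]%classic ->
  z [set` i] < +oo.
Proof.
move=> iab; apply: (le_lt_trans _ (lf_finite z (@segment_compact _ a b))).
by apply: le_measure; rewrite ?inE.
Qed.

Lemma measurable_eval_itvoo a b :
  measurable_fun setT (fun z : borelM R => lf_measure z `]a, b[%classic : \bar R).
Proof.
pose f n (z : borelM R) := (Rintegral z setT (tent a b n))%:E.
apply: (emeasurable_fun_cvg f) => //.
  move=> n; have h := vague_coord_measurable (tent_test a b n).
  by move/measurable_EFinP: h; exact.
move=> z _.
have mt n : measurable_fun [set: measurableTypeR R] (fun x => (tent a b n x)%:E).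
  apply/measurable_EFinP; apply: continuous_measurable_fun.
  exact: tent_continuous.
have -> : f ^~ z = fun n => \int[z]_x (tent a b n x)%:E.
  apply/funext => n; rewrite /f /Rintegral fineK// ge0_fin_numE; last first.
    by apply: integral_ge0 => x _; rewrite lee_fin tent_ge0.
  have : z `[a, b]%classic < +oo by exact: (@lf_itv_lty z _ a b).
  apply: le_lt_trans.
  rewrite -[in leRHS](setIT `[a, b]%classic) -integral_indic//.
  apply: ge0_le_integral => //.
  - by move=> x _; rewrite lee_fin tent_ge0.
  - exact/measurable_EFinP/measurable_indic.
  - move=> x _; rewrite lee_fin indicE.
    have [xab|xab] := boolP (x \in _); first by rewrite ge_min lexx.
    rewrite tent_out// => /andP[ax xb]; move/negP: xab; apply.
    by rewrite inE/= in_itv/= !ltW.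
have -> : z `]a, b[%classic = \int[z]_x limn (fun n => (tent a b n x)%:E).
  rewrite -[in LHS](setIT `]a, b[%classic) -integral_indic//.
  by apply: eq_integral => x _; apply/esym/cvg_lim => //; exact: tent_cvg.
apply: cvg_monotone_convergence => //.
- by move=> n x _; rewrite lee_fin tent_ge0.
- by move=> x _ m n mn; rewrite lee_fin tent_nd.
Qed.

End interval_evaluations.

Section kernels.
Context {R : realType}.

Lemma setI_itvoo (a b c e : R) :
  `]a, b[ `&` `]c, e[ = `]Num.max a c, Num.min b e[%classic.
Proof.
apply/seteqP; split=> x /=; rewrite !in_itv/= gt_max lt_min.
  by move=> [/andP[-> ->] /andP[-> ->]].
by move=> /andP[/andP[-> ->] /andP[-> ->]].
Qed.

Lemma cvg_measure_exhaust (mu : {measure set (measurableTypeR R) -> \bar R})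
    (A : set (measurableTypeR R)) : measurable A ->
  mu (A `&` `](- n%:R)%R, n%:R%R[%classic) @[n --> \oo] --> mu A.
Proof.
move=> mA.
have UA : \bigcup_n (A `&` `](- n%:R)%R, n%:R%R[%classic) = A.
  by rewrite -setI_bigcupr (bigcup_itvT false true) setIT.
rewrite -[in X in _ --> X]UA; apply: nondecreasing_cvg_mu => //.
- by move=> n; exact: measurableI.
- by rewrite UA.
- move=> m n mn; apply/subsetPset; apply: setIS; apply: subset_itv;
    by rewrite bnd_simp ?lerN2 ler_nat.
Qed.

(** The Borel sets [A] whose trace on a fixed bounded window has measurable mass
form a Dynkin system containing the open intervals; the window makes complements
harmless, since masses there are finite, and is removed at the end. *)
Lemma measurable_eval (A : set (measurableTypeR R)) : measurable A ->
  measurable_fun setT (fun z : borelM R => z A).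
Proof.
move=> mA; pose D (n : nat) : set (measurableTypeR R) := `](- n%:R)%R, n%:R%R[%classic.
apply: (emeasurable_fun_cvg (fun n (z : borelM R) => z (A `&` D n))); last first.
  by move=> z _; exact: cvg_measure_exhaust.
move=> n; move: A mA.
have mD : measurable (D n) by exact: measurable_itv.
have Dfin (z : lfMeasure R) B : measurable B -> z (B `&` D n) < +oo.
  move=> mB; apply: le_lt_trans (@lf_itv_lty _ z `](- n%:R)%R, n%:R%R[ (- n%:R)%R n%:R%R _).
    by apply: le_measure; rewrite ?inE//; exact: measurableI.
  by apply: subset_itv_oo_cc.
pose G := @RGenOpens.G R.
pose P := [set B : set (measurableTypeR R) |
  measurable_fun setT (fun z : borelM R => z (B `&` D n))].
have GI : setI_closed G.
  move=> _ _ [a [b ->]] [c [e ->]]; exists (Num.max a c), (Num.min b e).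
  exact: setI_itvoo.
have ME : @measurable _ (measurableTypeR R) = <<s G >>.
  exact: (RGenOpens.measurableE R).
have GP : G `<=` P.
  move=> _ [a [b ->]]; rewrite /P/= setI_itvoo.
  exact: measurable_eval_itvoo.
have PT : P setT by rewrite /P/= setTI; exact: measurable_eval_itvoo.
move=> A mA; apply: (dynkin_induction ME GI PT GP _ _ (_ : <<s G >> A)).
- move=> B mB PB; rewrite /P/=.
  have -> : (fun z : borelM R => z (~` B `&` D n)) =
      (fun z : borelM R => z (setT `&` D n) - z (B `&` D n)).
    apply/funext => z; rewrite setIC -setDE measureD//; last first.
      by rewrite -[D n]setTI; exact: Dfin.
    by rewrite setTI [in RHS]setIC.
  exact: emeasurable_funB.
- move=> F mF tF PF; rewrite /P/=.
  have -> : (fun z : borelM R => z (\bigcup_k F k `&` D n)) =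
      (fun z : borelM R => \sum_(k <oo | k \in xpredT) z (F k `&` D n)).
    apply/funext => z; rewrite setI_bigcupl measure_semi_bigcup//.
    + by move=> i; exact: measurableI.
    + exact: trivIset_setIr.
    + by apply: bigcup_measurable => i _; exact: measurableI.
  by apply: ge0_emeasurable_sum => // k _; exact: PF.
- by rewrite -ME.
Qed.

Context {d : measure_display} {X : measurableType d}.
Variable Z : X -> lfMeasure R.
Hypothesis mZ : forall A : set (measurableTypeR R), measurable A ->
  measurable_fun setT (fun x => Z x A).

(** A locally finite kernel need not be uniformly bounded on a window, but it is
finite there pointwise, which is enough for the Dynkin argument behind
[measurable_prod_subset_xsection_kernel]. *)
Lemma measurable_xsection_lf (A : set (X * measurableTypeR R)) : measurable A ->
  measurable_fun setT (fun x => Z x (xsection A x)).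
Proof.
move=> mA; pose D (n : nat) : set (measurableTypeR R) := `](- n%:R)%R, n%:R%R[%classic.
have mD n : measurable (D n) by exact: measurable_itv.
apply: (emeasurable_fun_cvg (fun n x => Z x (xsection A x `&` D n))); last first.
  by move=> x _; apply: cvg_measure_exhaust; exact: measurable_xsection.
move=> n.
pose K : R.-ker X ~> measurableTypeR R :=
  HB.pack (fun x => lf_measure (Z x)) (isKernel.Build _ _ _ _ R _ mZ).
have [] := @measurable_prod_subset_xsection_kernel _ _ X (measurableTypeR R) R K (D n) (mD n) _ A mA.
  move=> x; exists (fine (Z x (D n)) + 1)%R => B mB.
  have Dfin : Z x (D n) < +oo.
    by apply: (@lf_itv_lty _ _ _ (- n%:R)%R n%:R%R); exact: subset_itv_oo_cc.
  apply: (@le_lt_trans _ _ (Z x (D n))).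
    by apply: le_measure; rewrite ?inE//; exact: measurableI.
  by rewrite EFinD fineK ?ge0_fin_numE// lteDl// ?ge0_fin_numE ?lte_fin.
by move=> _; exact.
Qed.

Import HBNNSimple.

Lemma measurable_integral_lf (k : X * measurableTypeR R -> \bar R) :
  (forall t, 0 <= k t) -> measurable_fun setT k ->
  measurable_fun setT (fun x => \int[Z x]_u k (x, u)).
Proof.
move=> k0 mk; pose k_ := nnsfun_approx measurableT mk.
apply: (@measurable_fun_xsection_integral _ _ _ _ _ k (fun x => lf_measure (Z x)) k_).
- by move=> a b ab; exact/nd_nnsfun_approx.
- by move=> z; exact/cvg_nnsfun_approx.
- by move=> n r; apply: measurable_xsection_lf; exact: measurable_sfunP.
Qed.

End kernels.

Section shifts.
Context {R : realType}.
Implicit Types (u : R) (z : lfMeasure R).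

Lemma integral_shift u z (D : set (measurableTypeR R))
    (f : measurableTypeR R -> \bar R) :
  measurable D -> measurable_fun D f -> {in D, forall x, 0 <= f x} ->
  \int[lf_measure (shift u z)]_(x in D) f x =
  \int[z]_(x in [set x | D (x - u)%R]) f (x - u)%R.
Proof.
move=> mD mf f0.
have -> : (lf_measure (shift u z) : set (measurableTypeR R) -> \bar R) =
    pushforward z (translation u) := shift_measureE u z.
by rewrite ge0_integral_pushforward//; exact: measurable_translation.
Qed.

Lemma integral_shiftT u z (f : measurableTypeR R -> \bar R) :
  measurable_fun setT f -> (forall x, 0 <= f x) ->
  \int[lf_measure (shift u z)]_x f x = \int[z]_x f (x - u)%R.
Proof.
by move=> mf f0; rewrite integral_shift.
Qed.

Lemma shiftE u z (A : set (measurableTypeR R)) :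
  shift u z A = z [set x | A (x - u)%R].
Proof.
have -> : (lf_measure (shift u z) : set (measurableTypeR R) -> \bar R) =
    pushforward z (translation u) := shift_measureE u z.
by [].
Qed.

Lemma integral_lebesgue_shift u (f : measurableTypeR R -> \bar R) :
  measurable_fun setT f -> (forall x, 0 <= f x) ->
  \int[lebesgue_measure]_x f (x - u)%R = \int[lebesgue_measure]_x f x.
Proof.
move=> mf f0.
rewrite -(@ge0_integral_pushforward _ _ _ _ R _ (measurable_translation u) lebesgue_measure setT f)//.
pose mu : {measure set (measurableTypeR R) -> \bar R} :=
  measure_function_pushforward__canonical__measure_function_Measure
    lebesgue_measure (measurable_translation u).
apply: (eq_measure_integral lebesgue_measure (m1 := mu)) => A mA _; apply/esym.
apply: (@lebesgue_measure_unique R mu) => // _ [[a b]] _ <-.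
rewrite /mu/= /pushforward.
have -> : translation u @^-1` `]a, b] = `](a + u)%R, (b + u)%R]%classic.
  apply/seteqP; split=> x /=; rewrite /translation !in_itv/=.
    by rewrite ltrBrDr lerBlDr.
  by rewrite ltrBrDr lerBlDr.
rewrite !lebesgue_measure_itv/= !lte_fin ltrD2r -!EFinB.
by rewrite opprD addrACA subrr addr0.
Qed.

Lemma shift_test_subproof u (f : test_function R) :
  continuous (fun x => sval f (x - u)%R) /\
  compact (closure [set x | sval f (x - u)%R != 0%R]).
Proof.
case: f => f [cf kf] /=.
have cs (v : R) : continuous (fun x : R => x + v)%R.
  by move=> x; apply: cvgD; [exact: cvg_id|exact: cvg_cst].
split.
  by move=> x; apply: continuous_comp; [exact: (cs (- u)%R)|exact: cf].
pose K := (fun x : R => x + u)%R @` closure [set x | f x != 0%R].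
have cK : compact K.
  by apply: continuous_compact => //; apply: continuous_subspaceT.
apply: (subclosed_compact _ cK); first exact: closed_closure.
have /closure_id -> : closed K by apply: compact_closed => //; exact: Rhausdorff.
apply: closure_subset => x /= fx; exists (x - u)%R; last by rewrite subrK.
exact: subset_closure.
Qed.

(** The adjoint of the shift: it exhibits each coordinate of
[vague_eval (shift u z)] as another coordinate of [vague_eval z]. *)
Definition shift_test u (f : test_function R) : test_function R :=
  exist _ (fun x => sval f (x - u)%R) (shift_test_subproof u f).

Lemma Rintegral_shift u z (f : test_function R) :
  Rintegral (shift u z) setT (sval f) = Rintegral z setT (sval (shift_test u f)).
Proof.
rewrite /Rintegral; congr fine.
have mf : measurable_fun [set: measurableTypeR R] (fun x => (sval f x)%:E).
  apply/measurable_EFinP; apply: continuous_measurable_fun.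
  by case: (f) => g [].
rewrite integralE [in RHS]integralE; congr (_ - _).
- rewrite integral_shiftT//; last exact: measurable_funepos.
  by apply: eq_integral => x _; rewrite !funeposE.
- rewrite integral_shiftT//; last exact: measurable_funeneg.
  by apply: eq_integral => x _; rewrite !funenegE.
Qed.

Lemma shift_continuous u : continuous (shift u : lfMeasure R -> lfMeasure R).
Proof.
apply: (@continuous_comp_initial (lfMeasure R) (lfMeasure R) _ (@vague_eval R)).
move=> z; apply/cvg_sup; first exact/fmap_filter/(nbhs_filter z).
move=> f.
move=> U /= [_ [[V oV <-] Vz VU]].
apply: (filterS VU); first exact/fmap_filter/(nbhs_filter z).
have nV : nbhs (Rintegral z setT (sval (shift_test u f))) V.
  by rewrite -Rintegral_shift; exact: open_nbhs_nbhs.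
have := @vague_coord_continuous R (shift_test u f) z V nV.
apply: (filterS (F := nbhs z)) => z' /=.
by rewrite -Rintegral_shift.
Qed.

Lemma shift_measurable u : measurable_fun setT (shift u : borelM R -> borelM R).
Proof.
apply: (@measurability _ _ (borelM R) (borelM R) setT (shift u) (@open (lfMeasure R)) erefl).
move=> _ [A oA <-]; rewrite setTI; apply: sub_sigma_algebra.
by have /continuousP := @shift_continuous u; exact.
Qed.

(** [stationary] only compares probabilities of events.  Passing to integrals
requires the shifted process to have a law, hence [shift_measurable]. *)
Lemma integral_stationary d (T : measurableType d) (P : probability T R)
    (xi : {mfun T >-> borelM R}) (G : borelM R -> \bar R) u :
  stationary P xi -> measurable_fun setT G -> (forall z, 0 <= G z) ->
  \int[P]_w G (shift u (xi w)) = \int[P]_w G (xi w).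
Proof.
move=> sxi mG G0.
have mxi : measurable_fun setT xi by exact: measurable_funP.
have ms : measurable_fun setT (fun w => shift u (xi w)).
  exact: (measurableT_comp (@shift_measurable u)).
rewrite -(@ge0_integral_pushforward _ _ _ _ R _ mxi P setT G)//.
rewrite -(@ge0_integral_pushforward _ _ _ _ R _ ms P setT G)//.
pose m1 : {measure set (borelM R) -> \bar R} :=
  measure_function_pushforward__canonical__measure_function_Measure P mxi.
pose m2 : {measure set (borelM R) -> \bar R} :=
  measure_function_pushforward__canonical__measure_function_Measure P ms.
by apply: (eq_measure_integral m1 (m1 := m2)) => A mA _; exact: sxi.
Qed.

End shifts.

(** * Atoms of an integer-valued measure *)

Section integer_valued_paths.
Context {R : realType}.
Variable z : lfMeasure R.
Hypothesis iz : integer_valued z.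
Implicit Types a b s u v : R.

Lemma integer_valued_ge1 (A : set (measurableTypeR R)) :
  measurable A -> 0 < z A -> 1 <= z A.
Proof.
move=> mA zA; have [->|[k kE]] := iz mA; first by rewrite leey.
move: zA; rewrite kE lte_fin lee_fin ltr0z.
by rewrite gtz0_ge1 -(ler_int R).
Qed.

Lemma lf_itv_oc_lty a b : z `]a, b]%classic < +oo.
Proof. by apply: (@lf_itv_lty _ _ _ a b); apply: subset_itv; rewrite bnd_simp. Qed.

Lemma lf_bigcap_ge (F : (set (measurableTypeR R))^nat) (c : \bar R) :
  (forall n, measurable (F n)) -> z (F 0%N) < +oo -> nonincreasing_seq F ->
  (forall n, c <= z (F n)) -> c <= z (\bigcap_n F n).
Proof.
move=> mF F0 dF cF.
have cv : (z \o F) @ \oo --> z (\bigcap_n F n).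
  by apply: nonincreasing_cvg_mu => //; exact: bigcap_measurableType.
rewrite -(cvg_lim _ cv)//; apply: lime_ge; first exact: cvgP cv.
exact: nearW.
Qed.

(** The last atom is [s = inf {u <= b | z ]u, b] = 0}].  Continuity from below
gives [z ]s, b] = 0], so [s] cannot be [a].  Left of [s] the mass of []u, b]] is
positive, hence at least [1], and continuity from above leaves mass at least [1]
for [[s, b]], which must then sit at [s]. *)
Lemma last_atom a b : 0 < z `]a, b]%classic ->
  exists2 s, (a < s <= b)%R & 1 <= z [set s] /\ z `]s, b]%classic = 0.
Proof.
move=> zab.
pose S := [set u : R | (u <= b)%R /\ z `]u, b]%classic = 0].
have Sb : S b by split => //; rewrite set_itvoc0 measure0.
have Sa : lbound S a.
  move=> u [ub zu]; rewrite leNgt; apply/negP => ua.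
  move: zab; rewrite ltNge => /negP; apply; rewrite -zu.
  by apply: le_measure; rewrite ?inE//; apply: subset_itvr; rewrite bnd_simp ltW.
pose s := inf S.
have sa : (a <= s)%R by apply: lb_le_inf => //; exists b.
have sb : (s <= b)%R by apply: ge_inf => //; exists a.
have zs : z `]s, b]%classic = 0.
  pose F (n : nat) : set (measurableTypeR R) := `[(s + n.+1%:R^-1)%R, b]%classic.
  have cF : (z \o F) @ \oo --> z (\bigcup_n F n).
    apply: nondecreasing_cvg_mu => //.
    - by move=> n; exact: measurable_itv.
    - by apply: bigcupT_measurable => n; exact: measurable_itv.
    - move=> m n mn; apply/subsetPset; apply: subset_itvr; rewrite bnd_simp.
      by rewrite lerD2l lef_pV2 ?posrE// ler_nat.
  rewrite itv_open_bnd_bigcup -(cvg_lim _ cF)//.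
  rewrite (_ : z \o F = cst 0) ?lim_cst//; apply/funext => n /=.
  have [u [ub zu] us] : exists2 u, S u & (u < s + n.+1%:R^-1)%R.
    apply: inf_adherent; first by rewrite invr_gt0.
    by split; [exists b|exists a].
  apply/eqP; rewrite eq_le measure_ge0 andbT -zu.
  apply: le_measure; rewrite ?inE//; first exact: measurable_itv.
  by apply: subset_itvr; rewrite bnd_simp.
have sNa : (a < s)%R.
  rewrite lt_neqAle sa andbT; apply/eqP => as_; move: zab.
  by rewrite as_ zs ltxx.
exists s; first by rewrite sNa.
split => //.
have : 1 <= z `[s, b]%classic.
  have -> : `[s, b]%classic = \bigcap_n `](s - n.+1%:R^-1)%R, b]%classic :> set R.
    apply/seteqP; split => [x /= | x xF] /=.
      rewrite in_itv/= => /andP[sx xb] n _ /=.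
      by rewrite in_itv/= xb andbT ltrBlDr ltr_pwDr// invr_gt0.
    rewrite in_itv/=; apply/andP; split; last first.
      by have := xF 0%N I; rewrite /= in_itv/= => /andP[].
    apply/ler_addgt0Pr => e e0.
    near \oo => n.
    have := xF n I; rewrite /= in_itv/= => /andP[+ _].
    rewrite ltrBlDr => /ltW/le_trans; apply; rewrite lerD2l ltW//.
    by near: n; exact: (near_infty_natSinv_lt (PosNum e0)).
  apply: lf_bigcap_ge => //.
  - exact: lf_itv_oc_lty.
  - move=> m n mn; apply/subsetPset; apply: subset_itvr; rewrite bnd_simp.
    by rewrite lerB// lef_pV2 ?posrE// ler_nat.
  - move=> n; apply: integer_valued_ge1 => //.
    rewrite lt_neqAle measure_ge0 andbT eq_sym; apply/eqP => zn.
    have : S (s - n.+1%:R^-1)%R.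
      split => //; rewrite (le_trans _ sb)// gerBl invr_ge0.
      exact: ler0n.
    move=> /(ge_inf (ex_intro _ a Sa)); rewrite -/s leNgt => /negP; apply.
    by rewrite ltrBlDr ltrDl invr_gt0.
have -> : `[s, b]%classic = [set s] `|` `]s, b]%classic :> set R.
  by rewrite setU1itv.
rewrite measureU//; last first.
  by apply/seteqP; split => x //= [->]; rewrite in_itv/= ltxx.
by rewrite [X in _ + X]zs adde0.
Unshelve. all: by end_near. Qed.

(** Since []0, S]] is closed on the right and the masses of []0, S + 1/n]] are
integers, the infimum defining [tau1] is attained: an atom in each of these
intervals forces one in []0, S]]. *)
Lemma tau1_le S : (0 <= S)%R ->
  (tau1 z <= S%:E) = (0 < z `]0%R, S]%classic).
Proof.
move=> S0; apply/idP/idP; last first.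
  move=> /last_atom[s /andP[s0 sS] [zs _]].
  apply: (@le_trans _ _ s%:E); last by rewrite lee_fin.
  apply: ereal_inf_lbound; exists s => //; split => //.
  exact: lt_le_trans zs.
move=> tS; apply: (@lt_le_trans _ _ 1) => //.
have -> : `]0%R, S]%classic = \bigcap_n `]0%R, (S + n.+1%:R^-1)%R]%classic :> set R.
  apply/seteqP; split => [x /= | x xF] /=.
    rewrite in_itv/= => /andP[x0 xS] n _ /=.
    by rewrite in_itv/= x0/= (le_trans xS)// lerDl invr_ge0.
  rewrite in_itv/=; apply/andP; split.
    by have := xF 0%N I; rewrite /= in_itv/= => /andP[].
  apply/ler_addgt0Pr => e e0.
  near \oo => n.
  have := xF n I; rewrite /= in_itv/= => /andP[_ ].
  move=> /le_trans; apply; rewrite lerD2l ltW//.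
  by near: n; exact: (near_infty_natSinv_lt (PosNum e0)).
apply: lf_bigcap_ge => //.
- exact: lf_itv_oc_lty.
- move=> m n mn; apply/subsetPset; apply: subset_itvl; rewrite bnd_simp.
  by rewrite lerD2l lef_pV2 ?posrE// ler_nat.
- move=> n; apply: integer_valued_ge1 => //.
  have : tau1 z < (S + n.+1%:R^-1)%:E.
    by rewrite (le_lt_trans tS)// lte_fin ltrDl invr_gt0.
  move=> /ereal_inf_lt[_ [x [x0 zx] <-]]; rewrite lte_fin => xS.
  apply: (lt_le_trans zx); apply: le_measure; rewrite ?inE//.
  by move=> _ ->; rewrite /= in_itv/= x0 ltW.
Unshelve. all: by end_near. Qed.

Lemma tau1_ge0 : 0 <= tau1 z.
Proof. by apply: le_ereal_inf_tmp => _ [x [x0 _] <-]; rewrite lee_fin ltW. Qed.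

(** The points [u] of []a, b]] followed by no atom up to [b] are the last atom
[s] and the atom-free interval []s, b]]. *)
Lemma last_gap_measure a b : (forall x, z [set x] <= 1) ->
  z [set u : measurableTypeR R | (a < u <= b)%R /\ z `]u, b]%classic = 0] =
  ((0 < z `]a, b]%classic)%E%:R)%:E.
Proof.
move=> z1; case: (boolP (0 < z `]a, b]%classic)) => zab.
  have [s /andP[as_ sb] [zs zsb]] := last_atom zab.
  have -> : [set u : measurableTypeR R | (a < u <= b)%R /\ z `]u, b]%classic = 0]
     = [set s] `|` `]s, b]%classic.
    rewrite setU1itv//; apply/seteqP; split => u /=; rewrite in_itv/=.
      move=> [/andP[au ub] zu]; rewrite ub andbT leNgt; apply/negP => us.
      have : z [set s] <= z `]u, b]%classic.
        apply: le_measure; rewrite ?inE//.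
        by move=> _ ->; rewrite /= in_itv/= us.
      by rewrite zu leNgt (lt_le_trans _ zs).
    move=> /andP[su ub]; rewrite (lt_le_trans as_ su) ub; split => //.
    apply/eqP; rewrite eq_le measure_ge0 andbT -zsb.
    by apply: le_measure; rewrite ?inE//; apply: subset_itvr; rewrite bnd_simp.
  rewrite measureU//; last first.
    by apply/seteqP; split => x //= [->]; rewrite in_itv/= ltxx.
  by rewrite [X in _ + X]zsb adde0; apply/eqP; rewrite eq_le zs z1.
have z0 : z `]a, b]%classic = 0 by apply/eqP; rewrite eq_le measure_ge0 andbT leNgt.
rewrite (_ : [set u | _] = `]a, b]%classic)//.
apply/seteqP; split => u /=; rewrite in_itv/=; first by case.
move=> /andP[au ub]; rewrite au ub; split => //.
apply/eqP; rewrite eq_le measure_ge0 andbT -z0.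
by apply: le_measure; rewrite ?inE//; apply: subset_itvr; rewrite bnd_simp ltW.
Qed.

End integer_valued_paths.

(** * The points covered by an atom *)

Section gaps.
Context {R : realType}.
Implicit Types (z : lfMeasure R) (S u v x : R).

Definition ind (b : bool) : \bar R := (b%:R)%:E.

Lemma ind_ge0 b : 0 <= ind b. Proof. by rewrite /ind lee_fin ler0n. Qed.

Lemma measurable_ind d (Y : measurableType d) (b : Y -> bool) :
  measurable_fun setT b -> measurable_fun setT (fun y => ind (b y)).
Proof. by move=> mb; exact: (measurableT_comp (f := ind) _ mb). Qed.

Lemma integral_ind d (Y : measurableType d) (mu : {measure set Y -> \bar R})
    (b : Y -> bool) : measurable_fun setT b ->
  \int[mu]_y ind (b y) = mu [set y | b y].
Proof.
move=> mb; have mb1 : measurable [set y | b y].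
  by have := mb measurableT [set true] I; rewrite setTI.
rewrite -[in RHS](setIT [set y | b y]) -integral_indic//.
by apply: eq_integral => y _; rewrite indicE /ind mem_setE.
Qed.

(** When [u] is an atom, this says that [u] covers [x]: it is the last atom up to
[x], at distance less than [S].  Nothing here refers to atoms, so that joint
measurability in [z], [u] and [x] reduces to that of masses of intervals. *)
Definition gap S z u x : bool := (x - S < u <= x)%R && (z `]u, x]%classic == 0).

Lemma gap_shift S z y u x : gap S (shift y z) u x = gap S z (u + y) (x + y).
Proof.
rewrite /gap shiftE; congr (_ && (z _ == 0)).
  by rewrite lerD2r (addrAC x) ltrD2r.
by apply/seteqP; split => v /=; rewrite !in_itv/= ltrBrDr lerBlDr.
Qed.

Section measurability.
Context {d : measure_display} {Y : measurableType d}.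
Variables (W : Y -> lfMeasure R) (U V : Y -> measurableTypeR R).
Hypothesis mW : forall A : set (measurableTypeR R), measurable A ->
  measurable_fun setT (fun y => W y A).
Hypotheses (mU : measurable_fun setT U) (mV : measurable_fun setT V).

Lemma measurable_itv_oc_lf :
  measurable_fun setT (fun y => W y `]U y, V y]%classic).
Proof.
pose k (p : Y * measurableTypeR R) := ind ((U p.1 < p.2)%R && (p.2 <= V p.1)%R).
have -> : (fun y => W y `]U y, V y]%classic) = (fun y => \int[W y]_v k (y, v)).
  apply/funext => y; rewrite -(setIT `]U y, V y]%classic) -integral_indic//.
  apply: eq_integral => v _; rewrite indicE /k /ind/= mem_setE.
  by rewrite in_itv.
apply: measurable_integral_lf => //.
  by move=> t; exact: ind_ge0.
apply: measurable_ind; apply: measurable_and.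
- apply: measurable_fun_ltr; last exact: measurable_snd.
  exact: (measurableT_comp mU measurable_fst).
- apply: measurable_fun_ler; first exact: measurable_snd.
  exact: (measurableT_comp mV measurable_fst).
Qed.

Lemma measurable_gap S : measurable_fun setT (fun y => gap S (W y) (U y) (V y)).
Proof.
apply: measurable_and; first apply: measurable_and.
- by apply: measurable_fun_ltr => //; apply: measurable_funB.
- exact: measurable_fun_ler.
- by apply: measurable_fun_eqe => //; exact: measurable_itv_oc_lf.
Qed.

End measurability.

(** A copy of [lf_measure z] as a bare set function, on which the sigma-finite
structure required by Tonelli's theorem can be declared. *)
Definition lf_fun z : set (measurableTypeR R) -> \bar R := lf_measure z.

HB.instance Definition _ z := Measure.on (lf_fun z).

Lemma lf_sigma_finite z : sigma_finite setT (lf_fun z).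
Proof.
exists (fun n => `](- n%:R)%R, n%:R%R]%classic); first by rewrite bigcup_itvT.
move=> n; split; first exact: measurable_itv.
exact: lf_itv_oc_lty.
Qed.

HB.instance Definition _ z :=
  @Measure_isSigmaFinite.Build _ _ R (lf_fun z) (lf_sigma_finite z).

Lemma lf_fubini z (f : measurableTypeR R * measurableTypeR R -> \bar R) :
  measurable_fun setT f -> (forall p, 0 <= f p) ->
  \int[z]_u \int[lebesgue_measure]_x f (u, x) =
  \int[lebesgue_measure]_x \int[z]_u f (u, x).
Proof.
by move=> mf f0; exact: (@fubini_tonelli _ _ _ _ _ (lf_fun z) lebesgue_measure).
Qed.

(** The length of the set covered by the origin.  It equals [min(tau1 z, S)] on
integer-valued measures ([wait_tau1]) and, unlike [tau1], it is visibly
measurable on the whole space, so that the Palm distribution can be tested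
against it. *)
Definition wait S z : \bar R := \int[lebesgue_measure]_x ind (gap S z 0%R x).

Lemma wait_shift S z u :
  wait S (shift u z) = \int[lebesgue_measure]_x ind (gap S z u x).
Proof.
rewrite -(@integral_lebesgue_shift R (- u)%R (fun x => ind (gap S z u x))).
- apply: eq_integral => x _.
  by rewrite gap_shift add0r opprK.
- apply: measurable_ind.
  apply: (@measurable_gap _ (measurableTypeR R) (cst z) (cst u) id) => //.
- by move=> x; exact: ind_ge0.
Qed.

Lemma wait_le S z : (0 <= S)%R -> wait S z <= S%:E.
Proof.
move=> S0.
have -> : S%:E = \int[@lebesgue_measure R]_x ind (0 <= x < S)%R.
  rewrite integral_ind; last first.
    apply: measurable_and.
      by apply: measurable_fun_ler => //; exact: measurable_id.
    by apply: measurable_fun_ltr => //; exact: measurable_id.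
  rewrite (_ : [set _ | _] = `[0%R, S[%classic); last first.
    by apply/seteqP; split => x /=; rewrite in_itv.
  rewrite /= lebesgue_measure_itv/= lte_fin -EFinB subr0.
  case: ltP => // S0'.
  by have -> : S = 0%R by apply/eqP; rewrite eq_le S0 S0'.
apply: ge0_le_integral => //.
- by move=> x _; exact: ind_ge0.
- apply: measurable_ind.
  exact: (@measurable_gap _ (measurableTypeR R) (cst z) (cst 0%R) id).
- apply: measurable_ind; apply: measurable_and.
    by apply: measurable_fun_ler => //; exact: measurable_id.
  by apply: measurable_fun_ltr => //; exact: measurable_id.
- move=> x _; rewrite /ind lee_fin ler_nat /gap ltrBlDr add0r.
  by case: (x < S)%R; case: (0 <= x)%R => //=; case: eqP.
Qed.

Lemma wait_ge0 S z : 0 <= wait S z.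
Proof. by apply: integral_ge0 => x _; exact: ind_ge0. Qed.

Lemma wait_tau1 S z : integer_valued z -> (0 <= S)%R ->
  wait S z = mine (tau1 z) S%:E.
Proof.
move=> iz S0; rewrite /wait integral_ind; last first.
  exact: (@measurable_gap _ (measurableTypeR R) (cst z) (cst 0%R) id).
have t0 := @tau1_ge0 _ z.
pose m := fine (mine (tau1 z) S%:E).
have mE : m%:E = mine (tau1 z) S%:E.
  rewrite fineK// ge0_fin_numE ?le_min ?t0 ?lee_fin//.
  by rewrite gt_min ltry orbT.
have m0 : (0 <= m)%R by rewrite -lee_fin mE le_min t0 lee_fin.
rewrite (_ : [set _ | _] = `[0%R, m[%classic); last first.
  apply/seteqP; split => x /=; rewrite /gap in_itv/= ltrBlDr add0r.
    move=> /andP[/andP[xS x0] zx]; rewrite x0/= -lte_fin mE lt_min lte_fin xS andbT.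
    rewrite ltNge tau1_le//.
    by rewrite (eqP zx) ltxx.
  move=> /andP[x0 xm]; have : x%:E < mine (tau1 z) S%:E by rewrite -mE lte_fin.
  rewrite lt_min lte_fin => /andP[tx xS].
  rewrite xS x0/=; move: tx; rewrite ltNge tau1_le// -leNgt => zx.
  by rewrite eq_le zx measure_ge0.
rewrite /= lebesgue_measure_itv/= lte_fin -EFinB subr0 -mE.
case: ltP => // m0'.
by have -> : m = 0%R by apply/eqP; rewrite eq_le m0 m0'.
Qed.

Lemma measurable_wait S : measurable_fun setT (fun z : borelM R => wait S z).
Proof.
pose f (p : borelM R * measurableTypeR R) := ind (gap S p.1 0%R p.2).
apply: (@measurable_fun_fubini_tonelli_F _ _ _ _ R lebesgue_measure f) => //.
- apply: measurable_ind.
  apply: (@measurable_gap _ _ (fun p : borelM R * measurableTypeR R => p.1) (cst 0%R) snd) => //.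
  move=> A mA.
  exact: (measurableT_comp (measurable_eval mA) measurable_fst).
- by move=> p; exact: ind_ge0.
Qed.

End gaps.

(** * The Palm-Khinchin formula *)

Section palm_khinchin.
Context {R : realType} {d : measure_display} {T : measurableType d}.
Variables (P : probability T R) (xi : {mfun T >-> borelM R}).
Hypotheses (xi_pp : point_process xi) (xi_simple : simple_process P xi).
Hypothesis (xi_stat : stationary P xi).

Let mxi : measurable_fun setT (xi : T -> borelM R).
Proof. exact: measurable_funP. Qed.

Let mxiA d' (Y : measurableType d') (f : Y -> T) (mf : measurable_fun setT f)
    (A : set (measurableTypeR R)) : measurable A ->
  measurable_fun setT (fun y => xi (f y) A).
Proof.
move=> mA.
exact: (measurableT_comp (measurable_eval mA) (measurableT_comp mxi mf)).
Qed.

Lemma measurable_mem d' (Y : measurableType d') (B : set (measurableTypeR R))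
    (f : Y -> measurableTypeR R) : measurable B ->
  measurable_fun setT f -> measurable_fun setT (fun y => f y \in B).
Proof.
move=> mB mf; apply: (measurable_fun_bool true).
rewrite setTI [X in measurable X](_ : _ = f @^-1` B).
  by have := mf measurableT B mB; rewrite setTI.
by apply/seteqP; split => y /=; [move/set_mem|move/mem_set].
Qed.

Lemma prob_gt0_shift (a b u : R) :
  P [set w | 0 < xi w `](a + u)%R, (b + u)%R]%classic] =
  P [set w | 0 < xi w `]a, b]%classic].
Proof.
have mA : measurable [set z : borelM R | 0 < z `]a, b]%classic].
  have := measurable_fun_lte (measurable_cst 0) (measurable_eval (measurable_itv `]a, b])).
  by move=> /(_ measurableT [set true] I); rewrite setTI.
have E : [set x : R | `]a, b]%classic (x - u)%R] = `](a + u)%R, (b + u)%R]%classic.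
  by apply/seteqP; split => x /=; rewrite !in_itv/= ltrBrDr lerBlDr.
rewrite -(xi_stat u mA); congr (P _); apply/seteqP.
by split => w /=; rewrite shiftE E.
Qed.

Variables (B : set (measurableTypeR R)) (S : R).
Hypothesis mB : measurable B.

(** [G x (theta^x z)] is the number of atoms of [z] in [B] that cover [x]
([G_shift]); in this form the dependence on [x] left after using stationarity is
only through the translate of [B]. *)
Let G (x : R) (z : lfMeasure R) : \bar R :=
  \int[z]_v ind ((v + x \in B)%R && gap S z v 0%R).

Let mG d' (Y : measurableType d') (W : Y -> lfMeasure R) (X : Y -> measurableTypeR R)
    (mW : forall A : set (measurableTypeR R), measurable A ->
      measurable_fun setT (fun y => W y A)) : measurable_fun setT X ->
  measurable_fun setT (fun y => G (X y) (W y)).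
Proof.
move=> mX; pose k (p : Y * measurableTypeR R) : \bar R :=
  ind ((p.2 + X p.1 \in B)%R && gap S (W p.1) p.2 0%R).
apply: (@measurable_integral_lf R _ Y W mW k) => //.
  by move=> t; exact: ind_ge0.
apply: measurable_ind; apply: measurable_and.
  apply: measurable_mem => //; apply: measurable_funD; first exact: measurable_snd.
  exact: (measurableT_comp mX measurable_fst).
apply: (@measurable_gap R _ _ (fun p => W p.1) snd (cst 0%R)) => //.
by move=> A mA; exact: (measurableT_comp (mW A mA) measurable_fst).
Qed.

Let G_ge0 x z : 0 <= G x z.
Proof. by apply: integral_ge0 => v _; exact: ind_ge0. Qed.

Let G_shift x (z : lfMeasure R) : G x (shift x z) = \int[z]_u ind ((u \in B) && gap S z u x).
Proof.
rewrite /G integral_shiftT.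
- apply: eq_integral => u _.
  by rewrite gap_shift !subrK add0r.
- apply: measurable_ind; apply: measurable_and.
    by apply: measurable_mem => //; apply: measurable_funD.
  exact: (@measurable_gap R _ _ (cst (shift x z)) id (cst 0%R)).
- by move=> v; exact: ind_ge0.
Qed.

Let wait_palm (z : lfMeasure R) : \int[z]_(u in B) wait S (shift u z) =
  \int[lebesgue_measure]_x G x (shift x z).
Proof.
pose f (p : measurableTypeR R * measurableTypeR R) : \bar R := ind ((p.1 \in B) && gap S z p.1 p.2).
transitivity (\int[z]_u \int[lebesgue_measure]_x f (u, x)).
  rewrite integral_mkcond; apply: eq_integral => u _; rewrite patchE /f/=.
  case: ifPn => uB; first by rewrite wait_shift.
  by rewrite integral0_eq// => x _; rewrite /ind mul0r.
rewrite lf_fubini.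
- by apply: eq_integral => x _; rewrite G_shift.
- apply: measurable_ind; apply: measurable_and.
    by apply: measurable_mem => //; exact: measurable_fst.
  by apply: (@measurable_gap R _ _ (cst z) fst snd).
- by move=> p; exact: ind_ge0.
Qed.

(** Integrating over [x] first turns the translates of [B] into the factor
[lebesgue_measure B], and at most one atom covers the origin. *)
Let leb_G (z : lfMeasure R) : integer_valued z -> (forall x, z [set x] <= 1) ->
  \int[lebesgue_measure]_x G x z =
  lebesgue_measure B * ind (0 < z `](- S)%R, 0%R]%classic).
Proof.
move=> iz z1.
pose f (p : measurableTypeR R * measurableTypeR R) : \bar R :=
  ind ((p.1 + p.2 \in B)%R && gap S z p.1 0%R).
have mgap : measurable_fun setT (fun u : measurableTypeR R => gap S z u 0%R).
  exact: (@measurable_gap R _ _ (cst z) id (cst 0%R)).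
transitivity (\int[z]_v \int[lebesgue_measure]_x f (v, x)).
  rewrite lf_fubini//.
  - apply: measurable_ind; apply: measurable_and.
      apply: measurable_mem => //.
      by apply: measurable_funD; [exact: measurable_fst|exact: measurable_snd].
    by apply: (@measurable_gap R _ _ (cst z) fst (cst 0%R)).
  - by move=> p; exact: ind_ge0.
transitivity (\int[z]_v (lebesgue_measure B * ind (gap S z v 0%R))).
  apply: eq_integral => v _; rewrite /f/=.
  have mBv : measurable_fun setT (fun x : measurableTypeR R => x \in B).
    exact: measurable_mem.
  case: (gap S z v 0%R); last first.
    rewrite mule0; apply: integral0_eq => x _.
    by rewrite andbF.
  rewrite mule1; under eq_integral do rewrite andbT.
  have h := @integral_lebesgue_shift R (- v)%R (fun x => ind (x \in B)).
  transitivity (\int[@lebesgue_measure R]_x ind (x \in B)).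
    rewrite -h//; [|exact: measurable_ind|by move=> x; exact: ind_ge0].
    by apply: eq_integral => x _; rewrite opprK addrC.
  rewrite integral_ind//; congr (lebesgue_measure _).
  by apply/seteqP; split => x /=; [move/set_mem|move/mem_set].
rewrite ge0_integralZl//; last 2 first.
- exact: measurable_ind.
- by move=> v _; exact: ind_ge0.
rewrite integral_ind//; congr (_ * _).
rewrite /ind -last_gap_measure//; congr (lf_measure z _).
apply/seteqP; split => u /=; rewrite /gap sub0r.
  by move=> /andP[-> /eqP].
by move=> [-> ->]; rewrite eqxx.
Qed.

(** A mass transport identity: each atom in [B] gives mass to the points it
covers.  The mass sent from [B] is computed by [wait_palm]; seen from the
receiving points, stationarity allows all of them to be moved to the origin. *)
Lemma expected_wait :
  \int[P]_w \int[lf_measure (xi w)]_(u in B) wait S (shift u (xi w)) =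
  lebesgue_measure B * P [set w | 0 < xi w `]0%R, S]%classic].
Proof.
under eq_integral do rewrite wait_palm.
have mGw (W : T * measurableTypeR R -> lfMeasure R) :
   (forall A : set (measurableTypeR R), measurable A ->
      measurable_fun setT (fun y => W y A)) ->
   measurable_fun setT (fun p : T * measurableTypeR R => G p.2 (W p)).
  by move=> mW; apply: mG.
rewrite (fubini_tonelli (fun p : T * measurableTypeR R => G p.2 (shift p.2 (xi p.1)))); last 2 first.
- pose k (p : T * measurableTypeR R * measurableTypeR R) : \bar R :=
    ind ((p.2 \in B) && gap S (xi p.1.1) p.2 p.1.2).
  have -> : (fun p : T * measurableTypeR R => G p.2 (shift p.2 (xi p.1))) =
      (fun p => \int[xi p.1]_u k (p, u)).
    by apply/funext => p; rewrite G_shift.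
  apply: (@measurable_integral_lf R _ _ (fun p : T * measurableTypeR R => xi p.1) _ k).
  + by move=> A mA; apply: mxiA.
  + by move=> t; exact: ind_ge0.
  apply: measurable_ind; apply: measurable_and.
    by apply: measurable_mem => //; exact: measurable_snd.
  apply: (@measurable_gap R _ _ (fun p => xi p.1.1) snd (fun p => p.1.2)) => //.
    move=> A mA; apply: mxiA => //; exact: (measurableT_comp measurable_fst measurable_fst).
  exact: (measurableT_comp measurable_snd measurable_fst).
- by move=> p; exact: G_ge0.
transitivity (\int[lebesgue_measure]_x \int[P]_w G x (xi w)).
  apply: eq_integral => x _.
  apply: (@integral_stationary R _ _ P xi (fun z => G x z) x) => //.
  by apply: (@mG _ (borelM R) id (cst x)) => //; exact: measurable_eval.
rewrite -(fubini_tonelli (fun p : T * measurableTypeR R => G p.2 (xi p.1))); last 2 first.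
- by apply: mGw => A mA; apply: mxiA.
- by move=> p; exact: G_ge0.
have mE : measurable_fun setT (fun w => 0 < xi w `](- S)%R, 0%R]%classic).
  by apply: measurable_fun_lte => //; exact: (@mxiA _ _ id).
transitivity (\int[P]_w (lebesgue_measure B * ind (0 < xi w `](- S)%R, 0%R]%classic))).
  apply: ge0_ae_eq_integral => //.
  - apply: (@measurable_fun_fubini_tonelli_F _ _ _ _ R lebesgue_measure
      (fun p : T * measurableTypeR R => G p.2 (xi p.1))).
    + by apply: mGw => A mA; apply: mxiA.
    + by move=> p; exact: G_ge0.
  - by apply: measurable_funeM; exact: measurable_ind.
  - by move=> w _; apply: integral_ge0 => x _; exact: G_ge0.
  - by move=> w _; rewrite mule_ge0// ind_ge0.
  - by apply: filterS xi_simple => w w1 _; exact (leb_G (xi_pp w) w1).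
rewrite ge0_integralZl//; last 2 first.
- exact: measurable_ind.
- by move=> v _; exact: ind_ge0.
rewrite integral_ind//; congr (_ * _).
by have := prob_gt0_shift (- S)%R 0%R S; rewrite addNr add0r => ->.
Qed.

End palm_khinchin.

Section palm_consequences.
Context {R : realType} {d d' : measure_display}.
Context {T : measurableType d} {T' : measurableType d'}.
Variables (P : probability T R) (xi : {mfun T >-> borelM R}).
Variables (P' : probability T' R) (eta : {mfun T' >-> borelM R}).
Variables (r : R) (B : set (measurableTypeR R)).
Hypothesis mB : measurable B.
Hypotheses (B_gt0 : 0 < lebesgue_measure B) (B_lty : lebesgue_measure B < +oo).
Hypotheses (xi_pp : point_process xi) (xi_simple : simple_process P xi).
Hypothesis (xi_stat : stationary P xi).
Hypotheses (I_gt0 : 0 < intensity P xi r) (I_lty : intensity P xi r < +oo).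
Hypotheses (eta_pp : point_process eta) (eta_palm : palm_distributed r B P xi P' eta).

Let measurable_eta : measurable_fun setT (eta : T' -> borelM R).
Proof. exact: measurable_funP. Qed.

Let measurable_xi_itv (a b : R) : measurable [set w | 0 < xi w `]a, b]%classic].
Proof.
have mxi : measurable_fun setT (xi : T -> borelM R) by exact: measurable_funP.
have mA := measurableT_comp (measurable_eval (measurable_itv `]a, b])) mxi.
have := measurable_fun_lte (measurable_cst 0) mA.
by move=> /(_ measurableT [set true] I); rewrite setTI.
Qed.

Lemma mean_wait S : (0 <= S)%R ->
  \int[P']_w wait S (eta w) =
  (intensity P xi r)^-1 * P [set w | 0 < xi w `]0%R, S]%classic].
Proof.
move=> S0; pose f (z : borelM R) := fine (wait S z).
have fE (z : lfMeasure R) : (f z)%:E = wait S z.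
  rewrite /f fineK// ge0_fin_numE ?wait_ge0//.
  by rewrite (le_lt_trans (wait_le _ S0))// ltry.
have mf : measurable_fun setT f.
  exact: (measurableT_comp (fine_measurable measurableT) (@measurable_wait R S)).
have f0 z : (0 <= f z)%R by rewrite fine_ge0// wait_ge0.
have := eta_palm mf f0; under eq_integral do rewrite fE.
move=> ->; rewrite /palm.
under eq_integral do under eq_integral do rewrite fE.
rewrite expected_wait//.
move: I_gt0 I_lty B_gt0 B_lty.
case: (intensity P xi r) => // i; rewrite lte_fin => i0 _.
case: (lebesgue_measure B) => // b; rewrite lte_fin => b0 _.
have : P [set w | 0 < xi w `]0%R, S]%classic] \is a fin_num.
  exact: fin_num_measure.
case: (P _) => // p _.
rewrite -EFinM !inver !gt_eqF ?mulr_gt0// -!EFinM; congr EFin.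
by field; rewrite !gt_eqF.
Qed.

Lemma mean_min_tau1 S : (0 <= S)%R ->
  \int[P']_w mine (tau1 (eta w)) S%:E =
  (intensity P xi r)^-1 * P [set w | tau1 (xi w) <= S%:E].
Proof.
move=> S0; rewrite (_ : [set w | _] = [set w | 0 < xi w `]0%R, S]%classic]).
  rewrite -mean_wait//.
  by apply: eq_integral => w _; rewrite wait_tau1.
by apply/seteqP; split => w /=; rewrite tau1_le.
Qed.

Lemma min_tau1_cvg (z : lfMeasure R) :
  mine (tau1 z) (n%:R)%:E @[n --> \oo] --> tau1 z.
Proof.
have := @tau1_ge0 R z; case: (tau1 z) => [t| |]// t0.
- apply: cvg_near_cst.
  exists (Num.bound t) => // n /= tn.
  apply/min_idPl; rewrite lee_fin.
  have := archi_boundP (_ : 0 <= t)%R => /(_ t0)/ltW/le_trans; apply.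
  by rewrite ler_nat.
- under eq_fun do rewrite min_r ?leey//.
  apply/cvgeyPge => A; exists (Num.bound `|A|) => // n /= An.
  rewrite lee_fin (le_trans (ler_norm A))//.
  have := archi_boundP (normr_ge0 A) => /ltW/le_trans; apply.
  by rewrite ler_nat.
Qed.

Let measurable_min_tau1 (n : nat) :
  measurable_fun setT (fun w => mine (tau1 (eta w)) (n%:R)%:E).
Proof.
rewrite (_ : (fun w => _) = (fun w => wait n%:R (eta w))); last first.
  by apply/funext => w; rewrite wait_tau1.
exact: (measurableT_comp (@measurable_wait R n%:R) measurable_eta).
Qed.

Lemma measurable_tau1 : measurable_fun setT (fun w => tau1 (eta w)).
Proof.
apply: (emeasurable_fun_cvg (fun n w => mine (tau1 (eta w)) (n%:R)%:E)) => //.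
by move=> w _; exact: min_tau1_cvg.
Qed.

Lemma not_zeroE : [set w | ~ is_zero (xi w)] =
  \bigcup_n [set w | 0 < xi w `](- n%:R)%R, n%:R%R]%classic].
Proof.
apply/seteqP; split => [w /= nz|w [n _ /= xn] z]; last first.
  by move: xn; rewrite (z _ (measurable_itv _)) ltxx.
apply: contrapT => H; apply: nz => A mA.
apply/eqP; rewrite eq_le measure_ge0 andbT.
have -> : 0 = xi w setT.
  rewrite -(bigcup_itvT false false).
  have cF : (xi w \o (fun n => `](- n%:R)%R, n%:R%R]%classic)) @ \oo -->
      xi w (\bigcup_n `](- n%:R)%R, n%:R%R]%classic).
    apply: nondecreasing_cvg_mu => //.
    - by apply: bigcupT_measurable => n; exact: measurable_itv.
    - move=> m n mn; apply/subsetPset; apply: subset_itv;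
      by rewrite bnd_simp ?lerN2 ler_nat.
  rewrite -(cvg_lim _ cF)//.
  rewrite (_ : _ \o _ = cst 0) ?lim_cst//; apply/funext => n /=.
  apply/eqP; rewrite eq_le measure_ge0 andbT leNgt; apply/negP => x0.
  by apply: H; exists n.
by apply: le_measure; rewrite ?inE.
Qed.

Lemma not_zero_measurable : measurable [set w | ~ is_zero (xi w)].
Proof. by rewrite not_zeroE; apply: bigcupT_measurable. Qed.

(** By stationarity []0, 2n]] may be recentred to []-n, n]], and these intervals
exhaust the line. *)
Lemma prob_nonzero_cvg :
  P [set w | 0 < xi w `]0%R, (n + n)%:R%R]%classic] @[n --> \oo] -->
  P [set w | ~ is_zero (xi w)].
Proof.
rewrite not_zeroE.
rewrite (_ : (fun n => _) = (P \o (fun n => [set w | 0 < xi w `](- n%:R)%R, n%:R%R]%classic]))); last first.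
  apply/funext => n /=; rewrite -(prob_gt0_shift xi_stat (- n%:R)%R n%:R%R n%:R%R).
  by rewrite addNr -natrD.
apply: nondecreasing_cvg_mu => //.
  by apply: bigcupT_measurable.
move=> m n mn; apply/subsetPset => w /= /lt_le_trans; apply.
apply: le_measure; rewrite ?inE//; apply: subset_itv;
  by rewrite bnd_simp ?lerN2 ler_nat.
Qed.

Lemma mean_tau1 : \int[P']_w tau1 (eta w) =
  (intensity P xi r)^-1 * P [set w | ~ is_zero (xi w)].
Proof.
have Ifin : (intensity P xi r)^-1 \is a fin_num.
  by rewrite fin_numV// ?gt_eqF// (lt_trans _ I_gt0)// ltNy0.
have h1 := cvgeZl Ifin prob_nonzero_cvg.
have h2 : \int[P']_w mine (tau1 (eta w)) (n%:R)%:E @[n --> \oo] --> \int[P']_w tau1 (eta w).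
  rewrite [X in _ --> X](_ : _ = \int[P']_w limn (fun n => mine (tau1 (eta w)) (n%:R)%:E)).
    apply: cvg_monotone_convergence => //.
    - by move=> n w _; rewrite le_min tau1_ge0 lee_fin ler0n.
    - move=> w _ m n mn; rewrite le_min ge_min lexx/= ge_min lee_fin ler_nat mn.
      by rewrite orbT.
  by apply: eq_integral => w _; apply/esym/cvg_lim => //; exact: min_tau1_cvg.
have h3 : (fun n : nat => \int[P']_w mine (tau1 (eta w)) ((n + n)%:R)%:E) @ \oo -->
    \int[P']_w tau1 (eta w).
  apply: (cvg_comp (fun n => (n + n)%N) _ _ h2).
  move=> A [N _ NA]; exists N => // n /= Nn; apply: NA => /=.
  exact: leq_trans Nn (leq_addr _ _).
apply: (cvg_unique _ h3) => //.
rewrite (_ : (fun n => _) = (fun n => (intensity P xi r)^-1 *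
   P [set w | 0 < xi w `]0%R, (n + n)%:R%R]%classic])); first exact: h1.
apply/funext => n; rewrite -mean_wait//.
by apply: eq_integral => w _; rewrite wait_tau1.
Qed.

(** Otherwise [xi] would vanish almost surely and so would its intensity. *)
Lemma prob_nonzero_gt0 : 0 < P [set w | ~ is_zero (xi w)].
Proof.
rewrite lt_neqAle measure_ge0 andbT eq_sym; apply/eqP => p0.
move: I_gt0; rewrite /intensity.
rewrite (_ : \int[P]_w _ = 0) ?mul0e ?ltxx//.
have mxi : measurable_fun setT (fun w => xi w `]0%R, r]%classic).
  apply: (measurableT_comp (measurable_eval _)) => //.
rewrite (ge0_ae_eq_integral (g := cst 0)) ?integral0//.
exists [set w | ~ is_zero (xi w)]; split => //; first exact: not_zero_measurable.
by move=> w /= + z; apply => _; rewrite (z _ (measurable_itv _)).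
Qed.

Theorem mean_tau1_cond_prob S : (0 <= S)%R ->
  (\int[P']_w tau1 (eta w)) *
    cond_prob P [set w | tau1 (xi w) <= S%:E] [set w | ~ is_zero (xi w)] =
  \int[P']_w mine (tau1 (eta w)) S%:E.
Proof.
move=> S0; rewrite mean_tau1 mean_min_tau1// /cond_prob.
rewrite (_ : _ `&` _ = [set w | tau1 (xi w) <= S%:E]); last first.
  apply/seteqP; split => w /=; first by case.
  move=> tS; split => // z; move: tS; rewrite tau1_le//.
  by rewrite (z _ (measurable_itv _)) ltxx.
move: I_gt0 I_lty prob_nonzero_gt0.
case: (intensity P xi r) => // i; rewrite lte_fin => i0 _.
have : P [set w | ~ is_zero (xi w)] \is a fin_num.
  by apply: fin_num_measure; exact: not_zero_measurable.
case: (P [set w | ~ is_zero (xi w)]) => // p _; rewrite lte_fin => p0.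
have : P [set w | tau1 (xi w) <= S%:E] \is a fin_num.
  apply: fin_num_measure.
  rewrite (_ : [set w | _] = [set w | 0 < xi w `]0%R, S]%classic])//.
  by apply/seteqP; split => w /=; rewrite tau1_le.
case: (P _) => // q _.
rewrite !inver !gt_eqF// -!EFinM; congr EFin.
by field; rewrite ?gt_eqF.
Qed.

Lemma mean_tau1_lty : \int[P']_w tau1 (eta w) < +oo.
Proof.
rewrite mean_tau1; move: I_gt0 I_lty.
case: (intensity P xi r) => // i; rewrite lte_fin => i0 _.
have : P [set w | ~ is_zero (xi w)] \is a fin_num.
  by apply: fin_num_measure; exact: not_zero_measurable.
by case: (P _) => // p _; rewrite inver gt_eqF// -EFinM ltry.
Qed.

End palm_consequences.

(** * Weak convergence through the functions [min(., S)] *)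

Section weak_convergence.
Context {R : realType}.
Local Open Scope ring_scope.
Implicit Types (g f : R -> R) (x y : R).

Inductive min_span : (R -> R) -> Prop :=
| min_span_cst c : min_span (cst c)
| min_span_min S : 0 <= S -> min_span (fun x => Num.min x S)
| min_spanD f g : min_span f -> min_span g -> min_span (fun x => f x + g x)
| min_spanZ c f : min_span f -> min_span (fun x => c * f x).

Definition bounded_measurable g :=
  measurable_fun setT g /\ exists M, forall x, 0 <= x -> `|g x| <= M.

Lemma measurable_min_cst S : measurable_fun setT (fun x : R => Num.min x S).
Proof. exact: measurable_minr. Qed.

Lemma min_span_bounded_measurable g : min_span g -> bounded_measurable g.
Proof.
elim=> {g} [c|S S0|f g _ [mf [M fM]] _ [mg [N gN]]|c f _ [mf [M fM]]].
- by split; [exact: measurable_cst|exists `|c|].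
- split; first exact: measurable_min_cst.
  exists S => x x0; rewrite ger0_norm ?le_min ?x0//.
  by rewrite ge_min lexx orbT.
- split; first exact: measurable_funD.
  exists (M + N) => x x0.
  by rewrite (le_trans (ler_normD _ _))// lerD ?fM ?gN.
- split; first exact: measurable_funM.
  by exists (`|c| * M) => x x0; rewrite normrM ler_wpM2l// fM.
Qed.

Lemma heine_cantor g a b e : continuous g -> 0 < e ->
  exists n : nat, forall x y, a <= x <= b -> `|x - y| <= n.+1%:R^-1 ->
    `|g x - g y| <= e.
Proof.
move=> cg e0.
have := @segment_compact R a b; rewrite compact_near_coveringP.
move=> /(_ nat \oo (fun n x => forall y, `|x - y| <= n.+1%:R^-1 -> `|g x - g y| <= e)).
case.
  move=> x _.
  have e2 : 0 < e / 2 by rewrite divr_gt0.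
  have /cvgrPdist_le/(_ _ e2)[d /= d0 gd] := cg x.
  have d2 : 0 < d / 2 by rewrite divr_gt0.
  near=> x' n => /= y x'y.
  have xx' : `|x - x'| < d / 2 by near: x'; exists (d / 2).
  have nd : n.+1%:R^-1 < d / 2.
    by near: n; exact: (near_infty_natSinv_lt (PosNum d2)).
  have xy : `|x - y| < d.
    rewrite (splitr d) -(subrKA x') (le_lt_trans (ler_normD _ _))// ltrD//.
    exact: le_lt_trans nd.
  rewrite (splitr e) -(subrKA (g x)) (le_trans (ler_normD _ _))// lerD//.
    rewrite distrC; apply: gd => /=; rewrite (lt_trans xx')//.
    by rewrite ltr_pdivrMr// ltr_pMr// ltr1n.
  exact: gd.
move=> n _ /(_ n (leqnn n)) H; exists n => x y xab.
by apply: H; rewrite /= in_itv.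
Unshelve. all: by end_near. Qed.

(** Piecewise linear interpolation on the grid of mesh [1 / n.+1], by induction
on the number of cells: a new cell adds a multiple of a difference
[min(x, t m.+1) - min(x, t m)], which vanishes on the earlier cells and is
constant beyond the new one. *)
Lemma interpolation g e (n m : nat) : 0 <= e ->
  (forall x y, 0 <= x <= m%:R / n.+1%:R -> `|x - y| <= n.+1%:R^-1 ->
    `|g x - g y| <= e) ->
  exists2 h, min_span h &
    (forall x, m%:R / n.+1%:R <= x -> h x = g (m%:R / n.+1%:R)) /\
    (forall x, 0 <= x <= m%:R / n.+1%:R -> `|g x - h x| <= e).
Proof.
move=> e0; pose t (i : nat) : R := i%:R / n.+1%:R.
have n0 : 0 < n.+1%:R^-1 :> R by rewrite invr_gt0.
have tS i : t i.+1 = t i + n.+1%:R^-1 by rewrite /t -natr1 mulrDl mul1r.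
have t0 i : 0 <= t i by rewrite divr_ge0.
rewrite -/(t m); elim: m => [|m IH] osc.
  have t00 : t 0%N = 0 by rewrite /t mul0r.
  exists (cst (g 0)); first exact: min_span_cst.
  split => x; rewrite t00// => x0; have -> : x = 0 by apply/eqP; rewrite eq_le andbC.
  by rewrite subrr normr0.
have [|h sh [hR hL]] := IH.
  move=> x y /andP[x0 xt]; apply: osc; rewrite x0 (le_trans xt)//.
  by rewrite tS lerDl ltW.
pose c := (g (t m.+1) - g (t m)) * n.+1%:R.
exists (fun x => h x + (c * Num.min x (t m.+1) + (- c) * Num.min x (t m))).
  by apply: min_spanD => //; apply: min_spanD; apply: min_spanZ; apply: min_span_min.
have tm : t m <= t m.+1 by rewrite tS lerDl ltW.
split => x.
  move=> tx; rewrite (hR _ (le_trans tm tx)) (min_idPr tx) (min_idPr (le_trans tm tx)).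
  have st : t m.+1 - t m = n.+1%:R^-1 by rewrite tS addrAC subrr add0r.
  rewrite mulNr -mulrBr st /c -mulrA divff ?mulr1 ?gt_eqF//.
  by rewrite addrC subrK.
move=> /andP[x0 xt]; rewrite (min_idPl xt).
have [xtm|tmx] := leP x (t m).
  rewrite mulNr subrr addr0.
  by apply: hL; rewrite x0.
rewrite (hR _ (ltW tmx)).
(* On the new cell the interpolant is the convex combination with weight s. *)
pose s := (x - t m) * n.+1%:R.
have s0 : 0 <= s by rewrite mulr_ge0// subr_ge0 ltW.
have s1 : s <= 1 by rewrite /s -ler_pdivlMr// div1r lerBlDl -tS.
have xx : 0 <= x <= t m.+1 by rewrite x0.
have d1 : `|g x - g (t m)| <= e.
  by apply: osc => //; rewrite ger0_norm ?subr_ge0 ?(ltW tmx)// lerBlDl -tS.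
have d2 : `|g x - g (t m.+1)| <= e.
  apply: osc => //; rewrite distrC ger0_norm ?subr_ge0// lerBlDl.
  by rewrite tS lerD2r ltW.
rewrite (_ : _ - _ = (1 - s) * (g x - g (t m)) + s * (g x - g (t m.+1))); last first.
  by rewrite /s /c; ring.
clearbody s.
rewrite (le_trans (ler_normD _ _))// !normrM (ger0_norm s0) ger0_norm ?subr_ge0//.
rewrite [leRHS](_ : e = (1 - s) * e + s * e); last by ring.
by rewrite lerD// ler_wpM2l// subr_ge0.
Qed.

Lemma Rintegral_prob_cst d (T : measurableType d) (P : probability T R) (c : R) :
  \int[P]_w c = c.
Proof.
rewrite Rintegral_cst// -[RHS]mulr1; congr (_ * _).
by rewrite -[RHS]/(fine 1%E); congr fine; exact: probability_setT.
Qed.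

Section expectation.
Context {d : measure_display} {T : measurableType d} (P : probability T R).
Variable Y : T -> R.
Hypotheses (mY : measurable_fun setT Y) (Y0 : forall w, 0 <= Y w).

Lemma bounded_measurable_integrable g : bounded_measurable g ->
  P.-integrable setT (EFin \o (g \o Y)).
Proof.
move=> [mg [M gM]]; apply: measurable_bounded_integrable => //.
- by rewrite ltey_eq fin_num_measure.
- exact: measurableT_comp.
- exists M; split; first exact: num_real.
  move=> N MN w _ /=; rewrite (le_trans (gM _ _))//; exact: ltW.
Qed.

Lemma integral_bounded_measurable g : bounded_measurable g ->
  (\int[P]_w (g (Y w))%:E = (\int[P]_w g (Y w))%R%:E)%E.
Proof.
move=> bg; rewrite /Rintegral fineK//.
exact: (integrable_fin_num _ (bounded_measurable_integrable bg)).
Qed.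

Lemma dist_Rintegral g h r (e M : R) :
  bounded_measurable g -> bounded_measurable h -> bounded_measurable r ->
  (forall x, 0 <= x -> `|g x - h x| <= e + M * r x) ->
  `|\int[P]_w g (Y w) - \int[P]_w h (Y w)| <= e + M * \int[P]_w r (Y w).
Proof.
move=> bg bh br ghr.
have ig := bounded_measurable_integrable bg.
have ih := bounded_measurable_integrable bh.
have ir := bounded_measurable_integrable br.
have igh : P.-integrable setT (EFin \o (fun w => g (Y w) - h (Y w))).
  exact: (integrableB measurableT ig ih).
have ic : P.-integrable setT (EFin \o (fun _ : T => e)).
  exact: finite_measure_integrable_cst.
have iMr : P.-integrable setT (EFin \o (fun w => M * r (Y w))).
  exact: (integrableZl measurableT M ir).
rewrite -RintegralB// (le_trans (le_normr_Rintegral _ _))//.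
have -> : e + M * \int[P]_w r (Y w) = \int[P]_w (e + M * r (Y w)).
  by rewrite RintegralD// RintegralZl// Rintegral_prob_cst.
apply: le_Rintegral => //.
- exact: (integrable_norm igh).
- exact: (integrableD measurableT ic iMr).
- by move=> w _; exact: ghr.
Qed.

End expectation.



Definition ramp (K x : R) : R := Num.min x (K + 1) - Num.min x K.

Lemma ramp_span K : 0 <= K -> min_span (ramp K).
Proof.
move=> K0; rewrite (_ : ramp K = fun x => Num.min x (K + 1) + (-1) * Num.min x K).
  by apply: min_spanD; [|apply: min_spanZ]; apply: min_span_min; rewrite ?addr_ge0.
by apply/funext => x; rewrite mulN1r.
Qed.

Lemma ramp_ge0 K x : 0 <= ramp K x.
Proof. by rewrite subr_ge0 le_min2// lerDl. Qed.

Lemma ramp_le1 K x : ramp K x <= 1.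
Proof.
rewrite /ramp; have [xK|Kx] := leP x K.
  by rewrite (min_idPl _) ?subrr// (le_trans xK)// lerDl.
by rewrite lerBlDr addrC ge_min lexx orbT.
Qed.

Lemma ramp0 K x : x <= K -> ramp K x = 0.
Proof. by move=> xK; rewrite /ramp !(min_idPl _) ?subrr// (le_trans xK)// lerDl. Qed.

Lemma ramp1 K x : K + 1 <= x -> ramp K x = 1.
Proof.
move=> Kx; rewrite /ramp !(min_idPr _)// ?(le_trans _ Kx) ?lerDl//.
by rewrite addrAC subrr add0r.
Qed.

Lemma ramp_tight d (T : measurableType d) (P : probability T R) (Y : T -> R)
    (e : R) : measurable_fun setT Y -> 0 < e ->
  exists K : nat, \int[P]_w ramp K%:R (Y w) <= e.
Proof.
move=> mY e0.
have mr (K : R) : measurable_fun setT (fun w => ramp K (Y w)).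
  apply: (measurableT_comp (f := ramp K)) => //.
  by apply: measurable_funB; exact: measurable_min_cst.
have h : (\int[P]_w (ramp n%:R (Y w))%:E @[n --> \oo] --> \int[P]_w (cst 0 w))%E.
  apply: (@dominated_cvg _ _ _ _ _ _ _ _ (cst 1%E)) => //.
  - by move=> n; apply/measurable_EFinP; exact: mr.
  - move=> w _; apply: cvg_near_cst; exists (Num.bound `|Y w|) => // n /= Yn.
    rewrite ramp0// (le_trans (ler_norm _))//.
    have := archi_boundP (normr_ge0 (Y w)) => /ltW/le_trans; apply.
    by rewrite ler_nat.
  - exact: finite_measure_integrable_cst.
  - by move=> n w _; rewrite /= lee_fin ger0_norm ?ramp_ge0 ?ramp_le1.
rewrite integral0 in h.
move/fine_cvgP : h => [_ /cvgrPdist_le/(_ _ e0)[N _ /(_ N (leqnn N))]].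
rewrite /= sub0r normrN => hN; exists N.
exact: le_trans (ler_norm _) hN.
Qed.

(** Up to [K + 1] the interpolation error is [e]; beyond it both functions are
bounded by [M] and the ramp equals [1]. *)
Lemma min_span_dense g M (e : R) (K : nat) : continuous g ->
  (forall x, 0 <= x -> `|g x| <= M) -> 0 < e ->
  exists2 h, min_span h &
    forall x, 0 <= x -> `|g x - h x| <= e + (M + M) * ramp K%:R x.
Proof.
move=> cg gM e0.
have M0 : 0 <= M by apply: (le_trans (normr_ge0 (g 0))); exact: gM.
have [n osc] := heine_cantor 0 (K%:R + 1) cg e0.
have tE : (K.+1 * n.+1)%:R / n.+1%:R = K%:R + 1 :> R.
  by rewrite natrM mulfK ?natr1// pnatr_eq0.
have [|h sh [hR hL]] := @interpolation g e n (K.+1 * n.+1) (ltW e0).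
  by move=> x y; rewrite tE; exact: osc.
rewrite tE in hR hL.
exists h => // x x0; have [xK|Kx] := leP x (K%:R + 1).
  rewrite (le_trans (hL _ _)) ?x0// lerDl; apply: mulr_ge0; first exact: addr_ge0.
  exact: ramp_ge0.
rewrite ramp1 ?(ltW Kx)// mulr1 hR ?(ltW Kx)//.
rewrite (le_trans (ler_normB _ _))//.
by rewrite (le_trans (lerD (gM _ x0) (gM _ _))) ?addr_ge0// lerDr ltW.
Qed.

Section sequences.
Context {d : nat -> measure_display} {T : forall n, measurableType (d n)}.
Variables (P : forall n, probability (T n) R) (Y : forall n, T n -> R).
Hypotheses (mY : forall n, measurable_fun setT (@Y n)) (Y0 : forall n w, 0 <= @Y n w).
Context {d' : measure_display} {U : measurableType d'}.
Variables (Q : probability U R) (X : U -> R).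
Hypotheses (mX : measurable_fun setT X) (X0 : forall w, 0 <= X w).

(** Approximate [g] by [h] in the span, with error [e' + 2 M * ramp].  The
convergence hypothesis extends to [h] and to the ramp by linearity, and the ramp
has small expectation in the limit, hence eventually. *)
Lemma min_cvg_weak :
  (forall S, 0 <= S -> \int[P n]_w Num.min (@Y n w) S @[n --> \oo] -->
     \int[Q]_w Num.min (X w) S) ->
  forall g, continuous g -> (exists M, forall x, 0 <= x -> `|g x| <= M) ->
    \int[P n]_w g (@Y n w) @[n --> \oo] --> \int[Q]_w g (X w).
Proof.
move=> Hmin.
have Hspan f : min_span f ->
    \int[P n]_w f (@Y n w) @[n --> \oo] --> \int[Q]_w f (X w).
  elim=> {f} [c|S S0|f g sf cf sg cg|c f sf cf].
  - rewrite /= Rintegral_prob_cst; under eq_fun do rewrite Rintegral_prob_cst.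
    exact: cvg_cst.
  - exact: Hmin.
  - have bf := min_span_bounded_measurable sf.
    have bg := min_span_bounded_measurable sg.
    rewrite RintegralD//; [|exact: bounded_measurable_integrable..].
    under eq_fun do (rewrite RintegralD//; [|exact: bounded_measurable_integrable..]).
    exact: cvgD.
  - have bf := min_span_bounded_measurable sf.
    rewrite RintegralZl//; [|exact: bounded_measurable_integrable].
    under eq_fun do (rewrite RintegralZl//; [|exact: bounded_measurable_integrable]).
    by apply: cvgM => //; exact: cvg_cst.
move=> g cg [M gM]; apply/cvgrPdist_le => e e0.
have M0 : 0 <= M by apply: (le_trans (normr_ge0 (g 0))); exact: gM.
(* The total error is 3 e' + 6 M e': see eE below. *)
pose e' := e / (3 + 6 * M).
have D0 : 0 < 3 + 6 * M by rewrite ltr_wpDr// mulr_ge0.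
have e'0 : 0 < e' by rewrite divr_gt0.
have [K rK] := ramp_tight Q mX e'0.
have [h sh ghr] := min_span_dense K cg gM e'0.
have sr : min_span (ramp K%:R) by exact: ramp_span.
have bg : bounded_measurable g.
  by split; [exact: continuous_measurable_fun|exists M].
have bh := min_span_bounded_measurable sh.
have br := min_span_bounded_measurable sr.
have /cvgrPdist_le/(_ _ e'0) c1 := Hspan _ sh.
have /cvgrPdist_le/(_ _ e'0) c2 := Hspan _ sr.
near=> n.
have d1 : `|\int[Q]_w h (X w) - \int[P n]_w h (@Y n w)| <= e'.
  by near: n; exact: c1.
have d2 : `|\int[Q]_w ramp K%:R (X w) - \int[P n]_w ramp K%:R (@Y n w)| <= e'.
  by near: n; exact: c2.
have d3 := dist_Rintegral Q mX X0 bg bh br ghr.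
have d4 := dist_Rintegral (P n) (@mY n) (@Y0 n) bg bh br ghr.
have eE : e = e' + (M + M) * e' + e' + (e' + (M + M) * (e' + e')).
  rewrite -{1}(divfK (lt0r_neq0 D0) e) -/e'; ring.
rewrite eE.
set a := \int[Q]_w g (X w) in d3 *; set b := \int[P n]_w g (@Y n w) in d4 *.
set a' := \int[Q]_w h (X w) in d1 d3; set b' := \int[P n]_w h (@Y n w) in d1 d4.
rewrite (_ : a - b = (a - a') + (a' - b') - (b - b')); last by ring.
rewrite (le_trans (ler_normB _ _))// lerD//.
  rewrite (le_trans (ler_normD _ _))// lerD//.
  by rewrite (le_trans d3)// lerD2l ler_wpM2l ?addr_ge0.
rewrite (le_trans d4)// lerD2l ler_wpM2l ?addr_ge0//.
move: d2; rewrite ler_distlC => /andP[_ /le_trans]; apply.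
by rewrite lerD2r.
Unshelve. all: by end_near. Qed.

End sequences.

End weak_convergence.

(** * The limit law and the equivalence *)

Section final.
Context {R : realType}.

Section positive_part.
Variable rho : probability (measurableTypeR R) R.

Definition pos (x : measurableTypeR R) : R := Num.max 0%R x.

Lemma measurable_pos : measurable_fun setT pos.
Proof. by apply: measurable_maxr. Qed.

Lemma pos_ge0 x : (0 <= pos x)%R. Proof. by rewrite le_max lexx. Qed.

(** Tonelli, from [min(x^+, S) = |{u in [0, S] | u < x}|]. *)
Lemma integral_tail S : (0 <= S)%R ->
  \int[lebesgue_measure]_(u in `[0%R, S]) rho `]u, +oo[%classic =
  \int[rho]_x (Num.min (pos x) S)%:E.
Proof.
move=> S0.
pose f (p : measurableTypeR R * measurableTypeR R) : \bar R :=
  ind ((0 <= p.2 <= S) && (p.2 < p.1))%R.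
have mf : measurable_fun setT f.
  apply: measurable_ind; apply: measurable_and; first apply: measurable_and.
  - by apply: measurable_fun_ler => //; exact: measurable_snd.
  - by apply: measurable_fun_ler => //; exact: measurable_snd.
  - by apply: measurable_fun_ltr; [exact: measurable_snd|exact: measurable_fst].
have f0 p : 0 <= f p by exact: ind_ge0.
have := @fubini_tonelli _ _ _ _ R rho lebesgue_measure f mf f0.
rewrite [X in _ = X -> _](_ : _ =
  \int[lebesgue_measure]_(u in `[0%R, S]) rho `]u, +oo[%classic); last first.
  rewrite [RHS]integral_mkcond; apply: eq_integral => u _.
  rewrite patchE mem_setE in_itv/= /f/=; case: ifPn => uS.
    rewrite integral_ind; last first.
      by apply: measurable_fun_ltr.
    congr (rho _); apply/seteqP; split => x /=; rewrite in_itv/= andbT //.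
  by rewrite integral0_eq.
move=> <-; apply: eq_integral => x _.
rewrite /f/= integral_ind; last first.
  apply: measurable_and; first apply: measurable_and.
  - exact: measurable_fun_ler.
  - exact: measurable_fun_ler.
  - exact: measurable_fun_ltr.
have [xS|Sx] := ltP S x.
  rewrite (_ : [set _ | _] = `[0%R, S]%classic); last first.
    apply/seteqP; split => u /=; rewrite in_itv/=; first by case/andP.
    by move=> /andP[u0 uS]; rewrite u0 uS (le_lt_trans uS).
  rewrite /= lebesgue_measure_itv/= lte_fin -EFinB subr0.
  rewrite (min_idPr _); last by rewrite le_max (ltW xS) orbT.
  by case: ltP => // S0'; have -> : S = 0%R by apply/eqP; rewrite eq_le S0 S0'.
rewrite (_ : [set _ | _] = `[0%R, pos x[%classic); last first.
  apply/seteqP; split => u /=; rewrite in_itv/= lt_max.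
    by move=> /andP[/andP[-> _] ->]; rewrite orbT.
  move=> /andP[u0]; rewrite ltNge u0/= => ux; rewrite ux andbT.
  by rewrite (le_trans (ltW ux)).
rewrite /= lebesgue_measure_itv/= lte_fin -EFinB subr0.
rewrite (min_idPl _); last by rewrite ge_max S0.
case: ltP => // p0.
by have -> : pos x = 0%R by apply/eqP; rewrite eq_le p0 pos_ge0.
Qed.

Lemma integral_pos (g : R -> R) : rho `[0%R, +oo[%classic = 1 ->
  (bounded_measurable (g \o pos)) ->
  \int[rho]_(u in `[0%R, +oo[) (g u)%:E = \int[rho]_x (g (pos x))%:E.
Proof.
move=> rho1 bg.
pose N : set (measurableTypeR R) := ~` `[0%R, +oo[%classic.
have mN : measurable N by exact: measurableC.
have N0 : rho N = 0.
  by rewrite probability_setC// rho1 subee.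
rewrite (@negligible_integral _ _ _ rho setT N _ mN measurableT)//; last first.
  have [mg [M gM]] := bg.
  apply: (@measurable_bounded_integrable _ _ _ rho (g \o pos)) => //.
  - by rewrite ltey_eq fin_num_measure.
  - exists M; split; first exact: num_real.
    move=> K MK x _ /=; rewrite (le_trans _ (ltW MK))//.
    have := gM (pos x) (pos_ge0 x) => /=.
    by rewrite /pos (max_idPr _)//; exact: pos_ge0.
rewrite setTD setCK; apply: eq_integral => x.
by rewrite inE/= in_itv/= andbT => x0; rewrite /pos (max_idPr x0).
Qed.

End positive_part.

(** Composition with the positive part makes a function given on [[0, +oo[]
continuous on the whole line without changing it on nonnegative variables. *)
Lemma continuous_pos (g : R -> R) : {within `[0%R, +oo[, continuous g} ->
  continuous (g \o pos).
Proof.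
move=> /subspace_continuousP cg x.
have p0 : `[0%R, +oo[%classic (pos x) by rewrite /= in_itv/= pos_ge0.
have cp : pos @ x --> pos x.
  by apply: (@continuous_max R R (cst 0%R) id); [exact: cvg_cst|exact: cvg_id].
move=> V /(cg _ p0) WV.
have := cp _ WV; apply: (@filterS _ (nbhs x) _) => y /=; apply.
by rewrite in_itv/= pos_ge0.
Qed.

Lemma cvg_EFinP (u : nat -> R) (l : R) :
  (u n)%:E @[n --> \oo] --> l%:E <-> u @ \oo --> l.
Proof.
split=> [/fine_cvgP[]//|ul].
by apply/fine_cvgP; split => //; exact: nearW.
Qed.

(** [fine] sends [+oo] to [0], so integrability of [t] is what allows the
exchange. *)
Lemma integral_min_fine d (T : measurableType d) (P : probability T R)
    (t : T -> \bar R) S : measurable_fun setT t -> (forall w, 0 <= t w) ->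
  \int[P]_w t w < +oo -> (0 <= S)%R ->
  \int[P]_w mine (t w) S%:E = \int[P]_w (Num.min (fine (t w)) S)%:E.
Proof.
move=> mt t0 tfin S0.
have it : P.-integrable setT t.
  apply/integrableP; split => //.
  by under eq_integral do rewrite gee0_abs//.
have mft : measurable_fun setT (fun w => fine (t w)).
  exact: (measurableT_comp (fine_measurable measurableT) mt).
apply: ge0_ae_eq_integral => //.
- by apply: measurable_mine.
- by apply/measurable_EFinP; apply: measurable_minr.
- by move=> w _; rewrite le_min t0 lee_fin.
- by move=> w _; rewrite lee_fin le_min S0 fine_ge0.
- apply: filterS (integrable_ae measurableT it) => w + _ => /(_ I) tw.
  by rewrite EFin_min fineK.
Qed.

End final.

Theorem proposition6 (R : realType)
    (d : nat -> measure_display) (T : forall n, measurableType (d n))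
    (P : forall n, probability (T n) R)
    (xi : forall n, {mfun T n >-> borelM R})
    (d' : nat -> measure_display) (T' : forall n, measurableType (d' n))
    (P' : forall n, probability (T' n) R)
    (eta : forall n, {mfun T' n >-> borelM R})
    (r : R) (r_gt0 : (0 < r)%R)
    (B : set (measurableTypeR R)) (mB : measurable B)
    (B_gt0 : 0 < lebesgue_measure B) (B_lty : lebesgue_measure B < +oo)
    (xi_pp : forall n, point_process (xi n))
    (xi_simple : forall n, simple_process (P n) (xi n))
    (xi_stat : forall n, stationary (P n) (xi n))
    (I_gt0 : forall n, 0 < intensity (P n) (xi n) r)
    (I_lty : forall n, intensity (P n) (xi n) r < +oo)
    (eta_pp : forall n, point_process (eta n))
    (eta_palm : forall n,
      palm_distributed r B (P n) (xi n) (P' n) (eta n))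
    (E_bounded :
      ereal_sup (range (fun n => \int[P' n]_w tau1 (eta n w))) < +oo)
    (rho : probability (measurableTypeR R) R)
    (rho_ge0 : rho `[0%R, +oo[%classic = 1) :
  (forall S : R, (0 <= S)%R ->
     (fun n => (\int[P' n]_w tau1 (eta n w)) *
        cond_prob (P n) [set w | tau1 (xi n w) <= S%:E]
          [set w | ~ is_zero (xi n w)]) @ \oo -->
     \int[lebesgue_measure]_(u in `[0%R, S]) rho `]u, +oo[%classic)
  <->
  (forall g : R -> R, {within `[0%R, +oo[, continuous g} ->
     (exists M : R, forall x : R, (0 <= x)%R -> (`|g x| <= M)%R) ->
     (fun n => \int[P' n]_w (g (fine (tau1 (eta n w))))%:E) @ \oo -->
     \int[rho]_(u in `[0%R, +oo[) (g u)%:E).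
Proof.
pose Y n (w : T' n) : R := fine (tau1 (eta n w)).
have mtau n : measurable_fun setT (fun w => tau1 (eta n w)).
  exact: measurable_tau1.
have mY n : measurable_fun setT (@Y n).
  exact: (measurableT_comp (fine_measurable measurableT) (mtau n)).
have Y0 n w : (0 <= @Y n w)%R by rewrite fine_ge0// tau1_ge0.
have mpos := @measurable_pos R; have pos0 := @pos_ge0 R.
have bmin (S : R) : (0 <= S)%R -> bounded_measurable (fun x : R => Num.min x S).
  by move=> S0; apply: min_span_bounded_measurable; exact: min_span_min.
have min_iff (S : R) : (0 <= S)%R ->
  ((fun n => (\int[P' n]_w tau1 (eta n w)) *
        cond_prob (P n) [set w | tau1 (xi n w) <= S%:E]
          [set w | ~ is_zero (xi n w)]) @ \oo -->
     \int[lebesgue_measure]_(u in `[0%R, S]) rho `]u, +oo[%classic) <->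
  ((\int[P' n]_w Num.min (@Y n w) S)%R @[n --> \oo] -->
    (\int[rho]_w Num.min (pos w) S)%R).
  move=> S0; rewrite -cvg_EFinP integral_tail//.
  have -> : \int[rho]_x (Num.min (pos x) S)%:E = (\int[rho]_w Num.min (pos w) S)%R%:E.
    exact: (integral_bounded_measurable rho mpos pos0 (bmin _ S0)).
  rewrite (_ : (fun n => _ * _) = (fun n => (\int[P' n]_w Num.min (@Y n w) S)%R%:E))//.
  apply/funext => n.
  rewrite -(integral_bounded_measurable (P' n) (@mY n) (@Y0 n) (bmin _ S0)).
  rewrite (mean_tau1_cond_prob mB B_gt0 B_lty (xi_pp n) (xi_simple n)
    (@xi_stat n) (I_gt0 n) (I_lty n) (eta_pp n) (@eta_palm n) S0).
  apply: integral_min_fine => //; first by move=> w; exact: tau1_ge0.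
  exact: (mean_tau1_lty mB B_gt0 B_lty (xi_pp n) (xi_simple n)
    (@xi_stat n) (I_gt0 n) (I_lty n) (eta_pp n) (@eta_palm n)).
have bpos (g : R -> R) : {within `[0%R, +oo[, continuous g} ->
    (exists M : R, forall x : R, (0 <= x)%R -> (`|g x| <= M)%R) ->
    bounded_measurable (g \o pos).
  move=> cg [M gM]; split.
    by apply: continuous_measurable_fun; exact: continuous_pos.
  by exists M => x _; apply: gM; exact: pos_ge0.
have pos_id (x : R) : (0 <= x)%R -> pos x = x by move=> x0; exact/max_idPr.
have weak_iff (g : R -> R) (cg : {within `[0%R, +oo[, continuous g})
    (gM : exists M : R, forall x : R, (0 <= x)%R -> (`|g x| <= M)%R) :
  ((fun n => \int[P' n]_w (g (fine (tau1 (eta n w))))%:E) @ \oo -->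
     \int[rho]_(u in `[0%R, +oo[) (g u)%:E) <->
  ((\int[P' n]_w (g \o pos) (@Y n w))%R @[n --> \oo] -->
    (\int[rho]_w (g \o pos) (pos w))%R).
  have bg := bpos g cg gM.
  rewrite -cvg_EFinP integral_pos//.
  rewrite -(integral_bounded_measurable rho mpos pos0 bg).
  under [X in _ <-> _ --> X]eq_integral do rewrite /= pos_id ?pos0//.
  rewrite (_ : (fun n => \int[P' n]_w _) = (fun n => (\int[P' n]_w (g \o pos) (@Y n w))%R%:E))//.
  apply/funext => n.
  rewrite -(integral_bounded_measurable (P' n) (@mY n) (@Y0 n) bg).
  by apply: eq_integral => w _; rewrite /= pos_id.
split=> [Hi g cg gM|Hii S S0].
  apply/weak_iff => //.
  apply: (min_cvg_weak mY Y0 mpos pos0) => //.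
  - by move=> S S0; apply/min_iff => //; exact: Hi.
  - exact: continuous_pos.
  - by have [M gM'] := gM; exists M => x _; apply: gM'; exact: pos_ge0.
apply/min_iff => //.
have cS : {within `[0%R, +oo[, continuous (fun x : R => Num.min x S)}.
  apply: continuous_subspaceT => x.
  by apply: (@continuous_min R R id (cst S)); [exact: cvg_id|exact: cvg_cst].
have bS : exists M : R, forall x : R, (0 <= x)%R -> (`|Num.min x S| <= M)%R.
  by have [] := bmin _ S0.
have /weak_iff h := Hii _ cS bS.
have := h cS bS.
rewrite (_ : (fun n => _) = (fun n => (\int[P' n]_w Num.min (@Y n w) S)%R)); last first.
  by apply/funext => n; apply: eq_Rintegral => w _; rewrite /= pos_id.
rewrite (_ : (\int[rho]_w _)%R = (\int[rho]_w Num.min (pos w) S)%R)//.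
by apply: eq_Rintegral => w _; rewrite /= pos_id ?pos0.
Qed.
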